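(* If $G$ is any graph with at most $7$ vertices except $P_4$, $P_5$, $P_5^c$ or $T_{2,2}$, then $q(G)+q(G^c)\le |G|+2$.
   Context: All graphs are finite, undirected and simple; isomorphic graphs are identified; $|G|$ is the number of vertices of $G$, and $G^c$ is the complement of $G$. For a graph $G$ with vertex set $\{1,\dots,n\}$, $S(G)$ is the set of all real symmetric $n\times n$ matrices $A=(a_{ij})$ such that for $i\ne j$, $a_{ij}\neq 0$ if and only if $\{i,j\}$ is an edge of $G$ (no restriction on the diagonal). $q(A)$ is the number of distinct eigenvalues of $A$, and $q(G)=\min\{q(A): A\in S(G)\}$. $P_n$ is the path on $n$ vertices. $T_{2,2}$ is the graph on $5$ vertices obtained from the path with vertices $1,2,3,4,5$ in order by adding the edge $\{2,4\}$. *)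

(* Defs.v *)
From HB Require Import structures.
From mathcomp Require Import all_boot all_order all_algebra.
From mathcomp Require Import finmap.
From mathcomp Require Import boolp classical_sets cardinality reals.

Set Implicit Arguments.
Unset Strict Implicit.
Unset Printing Implicit Defensive.

Import Order.TTheory GRing.Theory Num.Theory.

Local Open Scope ring_scope.

Record sgraph (n : nat) := SGraph {
  adj :> rel 'I_n;
  adj_sym : symmetric adj;
  adj_irr : irreflexive adj
}.

Section Graphs.
Variable n : nat.

Definition compl_rel (G : sgraph n) : rel 'I_n :=
  fun i j => (i != j) && ~~ G i j.

Lemma compl_sym (G : sgraph n) : symmetric (compl_rel G).
Proof. by move=> i j; rewrite /compl_rel eq_sym adj_sym. Qed.

Lemma compl_irr (G : sgraph n) : irreflexive (compl_rel G).
Proof. by move=> i; rewrite /compl_rel eqxx. Qed.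

Definition compl (G : sgraph n) : sgraph n :=
  SGraph (@compl_sym G) (@compl_irr G).

Definition path_rel : rel 'I_n :=
  fun i j => (i.+1 == j :> nat) || (j.+1 == i :> nat).

Lemma path_sym : symmetric path_rel.
Proof. by move=> i j; rewrite /path_rel orbC. Qed.

Lemma path_irr : irreflexive path_rel.
Proof. by move=> i; rewrite /path_rel orbb gtn_eqF. Qed.

Definition path_graph : sgraph n := SGraph path_sym path_irr.

End Graphs.

(* Vertices are numbered from 0, so the edge {2,4} added to the path
   1,2,3,4,5 becomes {1,3}. *)
Definition T22_rel : rel 'I_5 :=
  fun i j => [|| path_rel i j, (i == 1 :> nat)%N && (j == 3 :> nat)%N
               | (i == 3 :> nat)%N && (j == 1 :> nat)%N].

Lemma T22_sym : symmetric T22_rel.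
Proof.
move=> i j; rewrite /T22_rel path_sym; congr (_ || _).
by rewrite orbC andbC; congr (_ || _); rewrite andbC.
Qed.

Lemma T22_irr : irreflexive T22_rel.
Proof. by case; do 5?case. Qed.

Definition T22 : sgraph 5 := SGraph T22_sym T22_irr.

Definition graph_iso (n m : nat) (G : sgraph n) (H : sgraph m) : Prop :=
  exists f : 'I_n -> 'I_m,
    bijective f /\ forall i j, H (f i) (f j) = G i j.

Section Q.
Variables (R : realType) (n : nat).

Definition inS (G : sgraph n) (A : 'M[R]_n) : Prop :=
  A^T = A /\ forall i j, i != j -> (A i j != 0) = G i j.

(* The set of eigenvalues is always finite, so the default value of [fset_set]
   on infinite sets is never used. For symmetric [A] all complex eigenvalues
   are real, so counting them in [R] loses nothing. *)
Definition num_eigenvalues (A : 'M[R]_n) : nat :=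
  #|` fset_set [set a : R | eigenvalue A a]%classic |%fset.

Lemma num_eigenvalues_attained (G : sgraph n) :
  exists k, `[< exists2 A : 'M[R]_n, inS G A & num_eigenvalues A = k >].
Proof.
pose A : 'M[R]_n := \matrix_(i, j) (G i j)%:R.
exists (num_eigenvalues A); apply/asboolP; exists A => //; split.
  by apply/matrixP => i j; rewrite !mxE adj_sym.
by move=> i j _; rewrite mxE pnatr_eq0 eqb0 negbK.
Qed.

Definition q (G : sgraph n) : nat := ex_minn (num_eigenvalues_attained G).

End Q.

Arguments path_graph n : clear implicits.
Arguments q R {n} G.

(* Main.v *)
From HB Require Import structures.
Require Import Defs.
From Stdlib Require Import BinInt.
From mathcomp Require Import all_boot all_order all_algebra.
From mathcomp Require Import finmap ring lra ssrZ.
From mathcomp Require Import boolp classical_sets functions cardinality reals.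
From mathcomp Require Import interval_inference topology normedtype sequences.

(** A symmetric matrix A has the strong spectral property when no nonzero symmetric
    matrix supported on the off-diagonal zeros of A commutes with A. This says that the
    similarity orbit of A is transversal to the space of symmetric matrices carried by the
    pattern of A. Hence small nonzero entries can be created at any chosen off-diagonal
    zeros of A while a correction on the pattern keeps the spectrum unchanged
    ([ssp_supergraph], proved with the contraction principle): if A lies in S(H), then
    q(G) <= q(A) for every graph G on the vertices of H that contains H.

    The property passes to direct sums of matrices with disjoint spectra
    ([ssp_bound_add]), and spectra are made disjoint by adding a scalar matrix. So if G
    contains vertex-disjoint copies of graphs H_1, ..., H_k, each with a matrix of S(H_i)
    that has the strong spectral property and c_i eigenvalues, then q(G) is at most
    c_1 + ... + c_k plus the number of remaining vertices ([spectral_bound_packing]).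
    Eight graphs suffice here: K3, C4, K_{2,3} with an edge added, the triangular prism and
    a graph contained in the complements of C7 and of all linear forests on 7 vertices, with
    2 eigenvalues, and K_{1,3}, C5 and C6, with 3 eigenvalues. Their matrices have integer
    entries. For 2 eigenvalues they are Gram matrices of tight frames, so that the graph is
    the complement of the orthogonality graph of a few vectors.

    It remains to see that, for at most 7 vertices, G and its complement contain packings
    whose total cost is at most n + 2. The graphs for which this fails are, up to
    complement, the exceptions of the theorem, the graphs P_k + K_1 with k = 2, 3, 4, where
    the isolated vertex can share an eigenvalue with the path, and one graph on 7 vertices;
    for these last four an explicit matrix is given. This finite statement is proved by
    branching on single edges until packings appear among the known edges and the known
    non-edges. Partial graphs met several times, up to isomorphism and complement, are
    treated once. The branching is recorded in tables, whose verification ([checkP]) is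
    an evaluation. *)

Set Implicit Arguments.
Unset Strict Implicit.
Unset Printing Implicit Defensive.

Import Order.TTheory GRing.Theory Num.Theory numFieldNormedType.Exports.

Local Open Scope ring_scope.

(** * Sup norm on matrices and the contraction principle *)

(** This joins the complete and the normed structures of matrices, as the contraction
    principle requires. *)
HB.instance Definition _ (R : realType) m n := Complete.on 'M[R]_(m, n).

Section MatrixNorm.
Variable R : realType.

Lemma norm_mx_entry m n (M : 'M[R]_(m, n)) i j : `|M i j| <= `|M|.
Proof.
rewrite [leRHS]/Num.Def.normr/= mx_normrE.
exact: (le_bigmax _ (fun ij : 'I_m * 'I_n => `|M ij.1 ij.2|) (i, j)).
Qed.

Lemma norm_mx_le m n (M : 'M[R]_(m, n)) c :
  0 <= c -> (forall i j, `|M i j| <= c) -> `|M| <= c.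
Proof.
move=> c0 Mc; rewrite [leLHS]/Num.Def.normr/= mx_normrE.
by apply: bigmax_le => // -[i j] _; exact: Mc.
Qed.

Lemma norm_mulmx_le m n p (M : 'M[R]_(m, n)) (N : 'M[R]_(n, p)) :
  `|M *m N| <= n%:R * (`|M| * `|N|).
Proof.
apply: norm_mx_le => [|i j]; first by rewrite !mulr_ge0.
rewrite mxE; apply: (le_trans (ler_norm_sum _ _ _)).
apply: (@le_trans _ _ (\sum_(k < n) `|M| * `|N|)).
  by apply: ler_sum => k _; rewrite normrM ler_pM// norm_mx_entry.
by rewrite sumr_const card_ord mulr_natl.
Qed.

Lemma linear_mx_bounded m n p q (f : {linear 'M[R]_(m, n) -> 'M[R]_(p, q)}) :
  exists2 C, 0 <= C & forall M, `|f M| <= C * `|M|.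
Proof.
exists (\sum_i \sum_j `|f (delta_mx i j)|).
  by apply: sumr_ge0 => i _; apply: sumr_ge0.
move=> M; rewrite {1}[M]matrix_sum_delta linear_sum mulr_suml.
apply: (le_trans (ler_norm_sum _ _ _)); apply: ler_sum => i _.
rewrite linear_sum mulr_suml.
apply: (le_trans (ler_norm_sum _ _ _)); apply: ler_sum => j _.
by rewrite linearZ normrZ mulrC ler_wpM2l// norm_mx_entry.
Qed.

Lemma mx_fixed_point n (e : R) (T : 'M[R]_n -> 'M[R]_n) : 0 < e ->
  (forall S, `|S| <= e -> `|T S| <= e) ->
  (forall S S', `|S| <= e -> `|S'| <= e -> `|T S - T S'| <= 2^-1 * `|S - S'|) ->
  exists2 S, `|S| <= e & T S = S.
Proof.
move=> e0 Te Tc; pose U : set 'M[R]_n := closed_ball 0 e.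
have UE S : U S <-> `|S| <= e.
  by rewrite /U closed_ballE// /closed_ball_ /= sub0r normrN.
have TU : {homo T : S / U S >-> U S} by move=> S /UE/Te/UE.
have [|||S /UE Se ST] := @banach_fixed_point R _ U (mkfun_fun TU).
- exists (2^-1)%:nng; split => /=; first by rewrite invf_lt1// ltr1n.
  by move=> [S S'] /= [/UE Se /UE Se']; exact: Tc.
- exact: closed_ball_closed.
- by exists 0; apply/UE; rewrite normr0 ltW.
by exists S.
Qed.

End MatrixNorm.

(** * The strong spectral property as surjectivity *)

Section StrongSpectralProperty.
Variables (R : realType) (n : nat).
Implicit Types A B X Y Z S D K : 'M[R]_n.

(** [ad A X] is the Lie bracket [X, A]: the derivative at 0 of t |-> exp(tX) A exp(-tX). *)
Definition ad A X := X *m A - A *m X.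

(** The diagonal always belongs to the pattern, because S(G) does not restrict it. *)
Definition mx_pattern A : rel 'I_n := fun i j => (i == j) || (A i j != 0).

Definition ssp A := forall X, X^T = X -> (forall i j, mx_pattern A i j -> X i j = 0) ->
  A *m X = X *m A -> X = 0.

Definition restrict_pattern A X : 'M[R]_n :=
  \matrix_(i, j) (X i j *+ mx_pattern A i j).

(** This is L L^* for L(D, K) = D + [K, A], where D is carried by the pattern of A and K is
    skew: on symmetric matrices the adjoint is L^*(Z) = (pattern part of Z, [Z, A]). *)
Definition ssp_gram A Z := restrict_pattern A Z + ad A (ad A Z).

(** An extension of [ssp_gram], up to a factor, to all matrices: it is the identity, up to
    a factor, on skew matrices, so that its bijectivity needs no subspace of symmetric
    matrices. *)
Definition ssp_endo A X := ssp_gram A (X + X^T) + (X - X^T).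

Lemma ad_is_linear A : linear (ad A).
Proof.
by move=> a X Y; rewrite /ad mulmxDl mulmxDr -scalemxAl -scalemxAr scalerBr opprD addrACA.
Qed.

HB.instance Definition _ A :=
  GRing.isLinear.Build R 'M[R]_n 'M[R]_n _ (ad A) (ad_is_linear A).

Lemma restrict_pattern_is_linear A : linear (restrict_pattern A).
Proof. by move=> a X Y; apply/matrixP => i j; rewrite !mxE mulrnDl mulrnAr. Qed.

HB.instance Definition _ A :=
  GRing.isLinear.Build R 'M[R]_n 'M[R]_n _ (restrict_pattern A) (restrict_pattern_is_linear A).

Lemma ssp_gram_is_linear A : linear (ssp_gram A).
Proof.
by move=> a X Y; rewrite /ssp_gram 3!linearP addrACA -scalerDr.
Qed.

HB.instance Definition _ A :=
  GRing.isLinear.Build R 'M[R]_n 'M[R]_n _ (ssp_gram A) (ssp_gram_is_linear A).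

Lemma ssp_endo_is_linear A : linear (ssp_endo A).
Proof.
move=> a X Y; rewrite /ssp_endo linearP.
have -> : a *: X + Y + (a *: X^T + Y^T) = a *: (X + X^T) + (Y + Y^T).
  by rewrite scalerDr addrACA.
have -> : a *: X + Y - (a *: X^T + Y^T) = a *: (X - X^T) + (Y - Y^T).
  by rewrite scalerBr opprD addrACA.
by rewrite linearP addrACA -scalerDr.
Qed.

HB.instance Definition _ A :=
  GRing.isLinear.Build R 'M[R]_n 'M[R]_n _ (ssp_endo A) (ssp_endo_is_linear A).

Lemma trmx_ad A X : A^T = A -> (ad A X)^T = - ad A X^T.
Proof. by move=> As; rewrite /ad linearB /= !trmx_mul As opprB. Qed.

Lemma mxtrace_mul_ad A K Z : \tr (Z *m ad A K) = - \tr (K *m ad A Z).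
Proof.
rewrite /ad !mulmxBr !linearB /= [\tr (Z *m (K *m A))]mxtrace_mulC.
rewrite [Z *m (A *m K)]mulmxA [\tr (Z *m A *m K)]mxtrace_mulC -[K *m A *m Z]mulmxA.
by rewrite opprK addrC.
Qed.

Lemma mxtrace_sqr_ge0 X : 0 <= \tr (X *m X^T).
Proof.
apply: sumr_ge0 => i _; rewrite mxE; apply: sumr_ge0 => j _.
by rewrite mxE -expr2 sqr_ge0.
Qed.

Lemma mxtrace_sqr_eq0 X : \tr (X *m X^T) = 0 -> X = 0.
Proof.
move=> X0; apply/matrixP => i j; rewrite mxE; apply/eqP; rewrite -sqrf_eq0 expr2.
have F0 i' : 0 <= (X *m X^T) i' i'.
  by rewrite mxE; apply: sumr_ge0 => k _; rewrite mxE -expr2 sqr_ge0.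
have /psumr_eq0P Xi := X0; have := Xi (fun i _ => F0 i) i isT; rewrite mxE => Xii.
have /psumr_eq0P Xij := Xii.
have := Xij _ j isT; rewrite mxE => -> //.
by move=> k _; rewrite mxE -expr2 sqr_ge0.
Qed.

Lemma restrict_pattern_sym A X : A^T = A -> X^T = X ->
  (restrict_pattern A X)^T = restrict_pattern A X.
Proof.
move=> As Xs; apply/matrixP => i j; rewrite !mxE /mx_pattern.
by rewrite -{1}As -{1}Xs !mxE eq_sym.
Qed.

(** <Z, ssp_gram A Z> = |pattern part of Z|^2 + |[Z, A]|^2, so a matrix Z in the kernel is
    one of those that the strong spectral property excludes. *)
Lemma ssp_gram_inj A Z : A^T = A -> ssp A -> Z^T = Z -> ssp_gram A Z = 0 -> Z = 0.
Proof.
move=> As Assp Zs Z0; pose K := ad A Z; pose P := restrict_pattern A Z.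
have Kskew : K^T = - K by rewrite trmx_ad// Zs.
have Ps : P^T = P by exact: restrict_pattern_sym.
have trK : \tr (Z *m ad A K) = \tr (K *m K^T).
  by rewrite Kskew mulmxN linearN /= mxtrace_mul_ad.
have trP : \tr (Z *m P) = \tr (P *m P^T).
  apply: eq_bigr => i _; rewrite !mxE; apply: eq_bigr => j _.
  rewrite -{1}Ps !mxE; case: (mx_pattern A i j); first by rewrite !mulr1n.
  by rewrite !mulr0n !mulr0.
have := congr1 (fun M => \tr (Z *m M)) Z0.
rewrite mulmx0 mxtrace0 mulmxDr linearD /= -/P -/K trK trP => /eqP.
rewrite paddr_eq0 ?mxtrace_sqr_ge0// => /andP[/eqP/mxtrace_sqr_eq0 P0 /eqP/mxtrace_sqr_eq0 K0].
apply: Assp => // [i j Aij|]; last by apply/eqP; rewrite eq_sym -subr_eq0; apply/eqP.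
by have /matrixP/(_ i j) := P0; rewrite !mxE Aij.
Qed.

Lemma trmx_ssp_gram A Z : A^T = A -> Z^T = Z -> (ssp_gram A Z)^T = ssp_gram A Z.
Proof.
move=> As Zs; rewrite linearD /= restrict_pattern_sym//; congr (_ + _).
by rewrite trmx_ad// trmx_ad// Zs linearN opprK.
Qed.

Lemma ssp_endo_symD A X : A^T = A ->
  ssp_endo A X + (ssp_endo A X)^T = ssp_gram A (X + X^T) *+ 2.
Proof.
move=> As; have Xs : (X + X^T)^T = X + X^T by rewrite linearD /= trmxK addrC.
have -> : (ssp_endo A X)^T = (ssp_gram A (X + X^T))^T - (X - X^T).
  by rewrite opprB; apply/matrixP => i j; rewrite !mxE.
by rewrite trmx_ssp_gram// addrACA subrr addr0 mulr2n.
Qed.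

Lemma mx_mulr2n_eq0 X : X *+ 2 = 0 -> X = 0.
Proof. by move/eqP; rewrite -scaler_nat scaler_eq0 pnatr_eq0 => /eqP. Qed.

Lemma ssp_endo_inj A X : A^T = A -> ssp A -> ssp_endo A X = 0 -> X = 0.
Proof.
move=> As Assp X0.
have Xs : (X + X^T)^T = X + X^T by rewrite linearD /= trmxK addrC.
have G0 : ssp_gram A (X + X^T) = 0.
  by apply: mx_mulr2n_eq0; rewrite -ssp_endo_symD// X0 trmx0 addr0.
have sX := ssp_gram_inj As Assp Xs G0.
have aX : X - X^T = 0 by move: X0; rewrite /ssp_endo G0 add0r.
apply: mx_mulr2n_eq0.
by rewrite -[RHS](addr0 0) -{1}sX -{1}aX addrACA subrr addr0.
Qed.

(** Transversality: every symmetric S is the sum of a matrix carried by the pattern of A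
    and of a bracket [K, A] with K skew, namely K = [f S, A]; the linearity of f serves
    to bound both terms by |S|. *)
Lemma ssp_right_inverse A : A^T = A -> ssp A ->
  exists f : {linear 'M[R]_n -> 'M[R]_n}, forall S,
    (f S)^T = f S /\ (S^T = S -> ssp_gram A (f S) = S).
Proof.
move=> As Assp; pose g := linfun (ssp_endo A).
have g0 : lker g == 0%VS.
  apply/lker0P => X Y; rewrite !lfunE /= => /eqP; rewrite -subr_eq0 -linearB /= => /eqP XY.
  by apply/eqP; rewrite -subr_eq0; apply/eqP; exact: ssp_endo_inj XY.
pose h S := let Y := (g^-1)%VF S in Y + Y^T.
have h_lin : linear h.
  by move=> a X Y; rewrite /h !linearP /= scalerDr addrACA.
pose hM := GRing.isLinear.Build R 'M[R]_n 'M[R]_n _ h h_lin.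
pose f : {linear 'M[R]_n -> 'M[R]_n} := HB.pack h hM.
exists f => S /=; have fs : (h S)^T = h S by rewrite /h linearD /= trmxK addrC.
split=> // Ss.
have gS : ssp_endo A ((g^-1)%VF S) = S.
  by have := lker0_lfunVK g0 S; rewrite lfunE.
apply/eqP; rewrite -subr_eq0; apply/eqP/mx_mulr2n_eq0.
by rewrite mulrnBl -ssp_endo_symD// gS Ss -mulr2n subrr.
Qed.
End StrongSpectralProperty.

(** * Perturbing a matrix without changing its spectrum *)

Section Perturbation.
Variables (R : realType) (n : nat).
Implicit Types A B X Y Z S D K : 'M[R]_n.

Lemma norm_mulmx_bound : exists2 N : R, 1 <= N & forall X Y a b,
  `|X| <= a -> `|Y| <= b -> `|X *m Y| <= N * (a * b).
Proof.
exists (n%:R + 1) => [|X Y a b Xa Yb]; first by rewrite lerDr ler0n.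
apply: (le_trans (norm_mulmx_le X Y)).
have a0 : 0 <= a by exact: le_trans Xa.
by rewrite ler_pM ?ler0n ?mulr_ge0// ?ler_pM// lerDl.
Qed.

(** For a fixed pattern part Z = [f S] of the unknown, put D = Z + E and K = [Z, A] / 2. The
    linear terms of the equation D + 2 [K, A] + [K, D] = K D K add up to S + E, so that
    the equation reads S = quad E D K, where the right-hand side is quadratic up to the
    prescribed term E. *)
Let quad E D K : 'M[R]_n := - E - ad D K + K *m D *m K.

Lemma quad_sub E D D' K K' : quad E D K - quad E D' K' =
  (D - D') *m K + D' *m (K - K') - ((K - K') *m D + K' *m (D - D'))
  + ((K - K') *m D *m K + K' *m (D - D') *m K + K' *m D' *m (K - K')).
Proof.
rewrite /quad /ad !mulmxBl !mulmxBr !mulmxBl.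
move: (K *m D *m K) (K' *m D *m K) (K' *m D' *m K) (K' *m D' *m K') => P1 P2 P3 P4.
move: (K *m D) (K' *m D) (K' *m D') (D *m K) (D' *m K) (D' *m K') => Q1 Q2 Q3 Q4 Q5 Q6.
by apply/matrixP => i j; rewrite !mxE; ring.
Qed.

Lemma trmx_quad E D K : E^T = E -> D^T = D -> K^T = - K -> (quad E D K)^T = quad E D K.
Proof.
move=> Es Ds Ks; rewrite /quad linearD linearB linearN /= Es trmx_ad// !trmx_mul Ks Ds.
by rewrite [ad D (- K)]linearN opprK !mulmxN !mulNmx opprK mulmxA.
Qed.

(** The equation between D and K says that (1 + K) (A + D) (1 - K) = (1 - K) A (1 + K), that
    is, A + D is the conjugate of A by the Cayley transform of the skew matrix K. *)
Lemma ssp_perturbation A (H : rel 'I_n) (d : R) : A^T = A -> ssp A -> symmetric H -> 0 < d ->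
  exists t D K, [/\ 0 < t, D^T = D, K^T = - K,
    D + ad A K *+ 2 + ad D K = K *m D *m K &
    forall i j, (mx_pattern A i j -> `|D i j| < d) /\
      (~~ mx_pattern A i j -> D i j = t *+ H i j)].
Proof.
move=> As Assp Hs d0.
have [N N1 mulN] := norm_mulmx_bound.
have [f f_inv] := ssp_right_inverse As Assp.
pose D0 := restrict_pattern A \o f; pose K0 S := 2^-1 *: ad A (f S).
have K0_lin : linear K0.
  by move=> a X Y; rewrite /K0 2!linearP scalerDr scalerA mulrC -scalerA.
pose K1 : {linear 'M[R]_n -> 'M[R]_n} :=
  HB.pack K0 (GRing.isLinear.Build R 'M[R]_n 'M[R]_n _ K0 K0_lin).
have [C C0 DC] := linear_mx_bounded D0.
have [C' C'0 KC] := linear_mx_bounded K1.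
have [M M1 [D0M K0M]] : exists2 M, 1 <= M &
    (forall S, `|D0 S| <= M * `|S|) /\ (forall S, `|K0 S| <= M * `|S|).
  exists (C + C' + 1); first by rewrite lerDr addr_ge0.
  split=> S; [apply: (le_trans (DC S)) | apply: (le_trans (KC S))];
    by rewrite ler_wpM2r//; lra.
(* c below bounds all the quadratic terms; 40 c <= 1 leaves room for the at most 11 of them. *)
have [e [e0 ed e40]] : exists e, [/\ 0 < e, M * e < d & 40 * (N ^+ 2 * M ^+ 3 * e) <= 1].
  pose w := 40 * (N ^+ 2 * M ^+ 3).
  have w0 : 0 < w.
    by rewrite mulr_gt0// mulr_gt0// exprn_gt0// (lt_le_trans ltr01).
  have M2 : 0 < 2 * M by lra.
  exists (Num.min (d / (2 * M)) w^-1); split.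
  - by rewrite lt_min divr_gt0 ?invr_gt0.
  - apply: (@le_lt_trans _ _ (M * (d / (2 * M)))).
      by rewrite ler_pM2l ?ge_min ?lexx//; apply: lt_le_trans M1.
    rewrite (_ : M * _ = d / 2); first lra.
    by field; apply/eqP; lra.
  - by rewrite mulrA -/w -ler_pdivlMl// mulr1 ge_min lexx orbT.
have [c cE] : exists c, c = N ^+ 2 * M ^+ 3 * e by exists (N ^+ 2 * M ^+ 3 * e).
rewrite -cE in e40.
have N0 : 0 <= N by exact: le_trans N1.
have M0 : 0 <= M by exact: le_trans M1.
have c0 : 0 <= c by rewrite cE (mulr_ge0 _ (ltW e0))// mulr_ge0 ?exprn_ge0.
have NM : N * M ^+ 2 <= N ^+ 2 * M ^+ 3.
  apply: ler_pM => //; first exact: exprn_ge0.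
    by rewrite expr2 ler_peMl.
  by rewrite [leRHS]exprS ler_peMl ?exprn_ge0.
have e1 : e <= 1.
  apply: le_trans (_ : 1 * e <= 1); first by rewrite mul1r.
  apply: le_trans (_ : c <= 1); last lra.
  by rewrite cE (ler_wpM2r (ltW e0))// mulr_ege1// exprn_ege1.
pose E : 'M[R]_n := \matrix_(i, j) (e / 2 *+ (H i j && ~~ mx_pattern A i j)).
have Ee : `|E| <= e / 2.
  apply: norm_mx_le => [|i j]; first lra.
  by rewrite mxE; case: (_ && _); rewrite ?mulr0n ?normr0 ?mulr1n ?gtr0_norm//; lra.
have [x xE] : exists x, x = M * e by exists (M * e).
rewrite -xE in ed.
have x0 : 0 <= x by rewrite xE; exact: mulr_ge0 M0 (ltW e0).
have ce0 : 0 <= c * e by exact: mulr_ge0 c0 (ltW e0).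
have Nxx : N * (x * x) <= c * e.
  rewrite (_ : N * _ = N * M ^+ 2 * e * e); last by rewrite xE; ring.
  by rewrite cE (ler_wpM2r (ltW e0))// (ler_wpM2r (ltW e0)).
have Nxxx : N * (N * (x * x) * x) <= c * e.
  rewrite (_ : N * _ = c * e * e); last by rewrite xE cE; ring.
  by rewrite -[leRHS]mulr1 ler_wpM2l.
have ce40 : 40 * (c * e) <= e by rewrite mulrA -[leRHS]mul1r (ler_wpM2r (ltW e0)).
pose DD S := D0 S + E.
have DDx S : `|S| <= e -> `|DD S| <= 2 * x.
  move=> Se; apply: (le_trans (ler_normD _ _)).
  have := D0M S; have : M * `|S| <= x by rewrite xE ler_wpM2l//; lra.
  have : e <= x by rewrite xE ler_peMl// ltW.
  lra.
have KKx S : `|S| <= e -> `|K0 S| <= x.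
  by move=> Se; apply: (le_trans (K0M S)); rewrite xE ler_wpM2l//; lra.
pose T S := quad E (DD S) (K0 S).
have [|| S Se ST] := @mx_fixed_point _ _ e T e0.
- move=> S Se; have Dx := DDx S Se; have Kx := KKx S Se.
  have KD := mulN _ _ _ _ Kx Dx; have DK := mulN _ _ _ _ Dx Kx.
  have KDK := mulN _ _ _ _ KD Kx.
  apply: (le_trans (ler_normD _ _)); apply: (le_trans (lerD (ler_normB _ _) KDK)).
  rewrite normrN; have := ler_normB (K0 S *m DD S) (DD S *m K0 S).
  rewrite -/(ad (DD S) (K0 S)).
  rewrite (_ : N * (x * (2 * x)) = 2 * (N * (x * x))) in KD *; last by ring.
  rewrite (_ : N * (2 * x * x) = 2 * (N * (x * x))) in DK; last by ring.
  rewrite (_ : N * (2 * _ * x) = 2 * (N * (N * (x * x) * x))); last by ring.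
  lra.
- move=> S S' Se Se'; set s := `|S - S'|.
  have Ks : `|K0 S - K0 S'| <= M * s by rewrite -[K0]/(K1 : _ -> _) -linearB K0M.
  have Ds : `|DD S - DD S'| <= M * s.
    by rewrite /DD opprD addrACA subrr addr0 -linearB D0M.
  have Dx := DDx S Se; have Kx := KKx S Se; have Dx' := DDx S' Se'; have Kx' := KKx S' Se'.
  have H1 := mulN _ _ _ _ Ks Dx; have H2 := mulN _ _ _ _ Kx' Ds.
  have H3 := mulN _ _ _ _ Ds Kx; have H4 := mulN _ _ _ _ Dx' Ks.
  have H5 := mulN _ _ _ _ H1 Kx; have H6 := mulN _ _ _ _ H2 Kx.
  have H7 := mulN _ _ _ _ (mulN _ _ _ _ Kx' Dx') Ks.
  have s0 : 0 <= s by exact: normr_ge0.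
  have pc : N * (M * x) * s <= c * s.
    rewrite ler_wpM2r// cE (_ : N * _ = N * M ^+ 2 * e); last by rewrite xE; ring.
    by rewrite (ler_wpM2r (ltW e0)).
  have rc : N * (N * (M * x) * x) * s <= c * s.
    rewrite ler_wpM2r// (_ : N * _ = c * e); last by rewrite xE cE; ring.
    by rewrite -[leRHS]mulr1 (ler_wpM2l c0).
  have cs : 40 * (c * s) <= s by rewrite mulrA -[leRHS]mul1r ler_wpM2r.
  rewrite (_ : N * _ = 2 * (N * (M * x) * s)) in H1; last by ring.
  rewrite (_ : N * _ = N * (M * x) * s) in H2; last by ring.
  rewrite (_ : N * _ = N * (M * x) * s) in H3; last by ring.
  rewrite (_ : N * _ = 2 * (N * (M * x) * s)) in H4; last by ring.
  rewrite (_ : N * _ = 2 * (N * (N * (M * x) * x) * s)) in H5; last by ring.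
  rewrite (_ : N * _ = N * (N * (M * x) * x) * s) in H6; last by ring.
  rewrite (_ : N * _ = 2 * (N * (N * (M * x) * x) * s)) in H7; last by ring.
  rewrite /T quad_sub.
  apply: le_trans (ler_normD _ _) _.
  apply: le_trans (lerD (ler_normB _ _) (ler_normD _ _)) _.
  apply: le_trans (lerD (lerD (ler_normD _ _) (ler_normD _ _)) (lerD (ler_normD _ _) (lexx _))) _.
  lra.
have [fs fS] := f_inv S.
have Hps i j : mx_pattern A i j = mx_pattern A j i.
  by rewrite /mx_pattern eq_sym -{1}As mxE.
have Es : E^T = E by apply/matrixP => i j; rewrite !mxE Hs Hps.
have Ds : (DD S)^T = DD S by rewrite linearD /= Es restrict_pattern_sym.
have Ks : (K0 S)^T = - K0 S by rewrite linearZ /= trmx_ad// fs scalerN.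
have Ss : S^T = S.
  by rewrite -ST trmx_quad.
exists (e / 2), (DD S), (K0 S); split=> //; first lra.
  have -> : ad A (K0 S) *+ 2 = ad A (ad A (f S)).
    by rewrite linearZ /= -scaler_nat scalerA mulfV ?pnatr_eq0// scale1r.
  have DS : DD S + ad A (ad A (f S)) = S + E by rewrite addrAC -[D0 S + _]/(ssp_gram A (f S)) (fS Ss).
  rewrite DS -{1}ST /T /quad.
  by apply/matrixP => i j; rewrite !mxE; ring.
move=> i j; split => pij.
  have -> : DD S i j = D0 S i j by rewrite !mxE pij andbF mulr0n addr0.
  apply: le_lt_trans (norm_mx_entry _ _ _) _; apply: le_lt_trans (D0M S) _.
  by apply: le_lt_trans ed; rewrite xE ler_wpM2l//; lra.
by rewrite !mxE (negbTE pij) mulr0n add0r andbT.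
Qed.
End Perturbation.

Section Supergraph.
Variables (R : realType) (n : nat).
Implicit Types (A B U K : 'M[R]_n) (rs : seq R).

(** Bounds on q come from matrices killed by a product of linear factors; a list of
    candidate eigenvalues is easier to carry along than the exact spectrum. *)
Definition root_prod rs A : 'M[R]_n := foldr (fun r M => (A - r%:M) *m M) 1%:M rs.

Lemma root_prod_similar rs A B U :
  B *m U = U *m A -> root_prod rs B *m U = U *m root_prod rs A.
Proof.
move=> BU; elim: rs => [|r rs IH] /=; first by rewrite mul1mx mulmx1.
by rewrite -mulmxA IH !mulmxA mulmxBl mulmxBr BU scalar_mxC.
Qed.

(** If v (1 + K) = 0 then v v^T = - v K v^T, and v K v^T = 0 because K is skew. *)
Lemma unitmx_skew_add1 K : K^T = - K -> 1%:M + K \in unitmx.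
Proof.
move=> Ks; rewrite -row_free_unit -kermx_eq0; apply/eqP/row_matrixP => i.
set v := row i _; have : v *m (1%:M + K) = 0 by rewrite -row_mul mulmx_ker row0.
rewrite row0 mulmxDr mulmx1 => vK.
have vKv : v *m K *m v^T = 0.
  have s : (v *m K *m v^T)^T = - (v *m K *m v^T).
    by rewrite !trmx_mul trmxK Ks mulNmx mulmxN mulmxA.
  apply/eqP; have /eqP := s; rewrite [X in X^T]mx11_scalar tr_scalar_mx -mx11_scalar.
  by rewrite -subr_eq0 opprK -mulr2n -scaler_nat scaler_eq0 pnatr_eq0.
have vv : v *m v^T = 0 by rewrite -[LHS](addr0) -vKv -mulmxDl vK mul0mx.
apply/rowP => j; rewrite [RHS]mxE; apply/eqP; rewrite -sqrf_eq0 expr2.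
have /matrixP/(_ 0 0) := vv; rewrite !mxE => /psumr_eq0P.
move=> /(_ _ j isT); rewrite !mxE => -> // k _.
by rewrite !mxE -expr2 sqr_ge0.
Qed.

(** The perturbation D is too small to cancel an entry of A, and it is equal to t > 0 at the
    new edges and to 0 at the non-edges of H. *)
Theorem ssp_supergraph rs A (H : rel 'I_n) : A^T = A -> ssp A -> symmetric H ->
  (forall i j, i != j -> A i j != 0 -> H i j) -> root_prod rs A = 0 ->
  exists B, [/\ B^T = B, forall i j, i != j -> (B i j != 0) = H i j & root_prod rs B = 0].
Proof.
move=> As Assp Hs AH A0.
have [d d0 dA] : exists2 d : R, 0 < d & forall i j, A i j != 0 -> d <= `|A i j|.
  exists (\big[Num.min/1]_(ij : 'I_n * 'I_n | A ij.1 ij.2 != 0) `|A ij.1 ij.2|).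
    by apply: lt_bigmin => [|ij Aij]; rewrite ?ltr01 ?normr_gt0.
  by move=> i j Aij; exact: (@bigmin_le_cond _ R _ 1 (i, j)).
have [t [D [K [t0 Ds Ks DK Dij]]]] := ssp_perturbation As Assp Hs d0.
have uK : 1%:M + K \in unitmx by exact: unitmx_skew_add1.
have uK' : 1%:M - K \in unitmx by apply: unitmx_skew_add1; rewrite linearN /= Ks.
exists (A + D); split.
- by rewrite linearD /= As Ds.
- move=> i j ij; have [Dlt Deq] := Dij i j; rewrite mxE.
  have [A0ij|Aij] := eqVneq (A i j) 0.
    rewrite A0ij add0r Deq; last by rewrite /mx_pattern negb_or ij A0ij eqxx.
    by case: (H i j); rewrite ?mulr1n ?mulr0n ?eqxx// gt_eqF.
  rewrite (AH _ _ ij Aij); apply/negP => /eqP AD.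
  have := Dlt _; rewrite /mx_pattern Aij orbT => /(_ isT).
  by rewrite -(addr0_eq AD) normrN ltNge dA.
- pose U := invmx (1%:M + K) *m (1%:M - K).
  have uU : U \in unitmx by rewrite unitmx_mul unitmx_inv uK.
  have KAD : (1%:M + K) *m (A + D) *m (1%:M - K) = (1%:M - K) *m A *m (1%:M + K).
    move: DK; rewrite /ad !(mulmxDr, mulmxDl, mulmxN, mulNmx, mul1mx, mulmx1).
    move: (K *m D *m K) (K *m A *m K) => P1 P2.
    move: (K *m D) (D *m K) (K *m A) (A *m K) => Q1 Q2 Q3 Q4 DK.
    by apply/matrixP => i j; move/matrixP/(_ i j): DK; rewrite !mxE; lra.
  have KK : (1%:M + K) *m (1%:M - K) = (1%:M - K) *m (1%:M + K).
    rewrite !(mulmxDr, mulmxDl, mulmxN, mulNmx, mul1mx, mulmx1).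
    by apply/matrixP => i j; rewrite !mxE; ring.
  have BU : (A + D) *m U = U *m A.
    have UE : U = (1%:M - K) *m invmx (1%:M + K).
      apply: (can_inj (mulKmx uK)); apply: (can_inj (mulmxK uK)).
      by rewrite /U mulKVmx// -[RHS]mulmxA mulmxKV// KK.
    apply: (can_inj (mulKmx uK)).
    by rewrite {1}UE !mulmxA KAD mulmxK// /U -!mulmxA mulKVmx//.
  have := root_prod_similar rs BU; rewrite A0 mulmx0 => /(congr1 (mulmxr (invmx U))).
  by rewrite /= mulmxK// mul0mx.
Qed.
End Supergraph.

(** * Eigenvalue bounds and direct sums *)

Section RootProduct.
Variable R : realType.

Lemma root_prod_cat n (rs rs' : seq R) (A : 'M_n) :
  root_prod (rs ++ rs') A = root_prod rs A *m root_prod rs' A.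
Proof. by elim: rs => [|r rs IH] /=; rewrite ?mul1mx// IH mulmxA. Qed.

Lemma root_prod_shift n (t : R) rs (A : 'M_n) :
  root_prod [seq r + t | r <- rs] (A + t%:M) = root_prod rs A.
Proof.
elim: rs => //= r rs ->; congr (_ *m _).
by rewrite raddfD /= opprD addrACA subrr addr0.
Qed.

Lemma root_prod_block m n rs (A : 'M[R]_m) (B : 'M[R]_n) :
  root_prod rs (block_mx A 0 0 B) = block_mx (root_prod rs A) 0 0 (root_prod rs B).
Proof.
elim: rs => [|r rs IH] /=; first by rewrite scalar_mx_block.
rewrite IH scalar_mx_block opp_block_mx add_block_mx mulmx_block !oppr0 !addr0.
by rewrite !mulmx0 !mul0mx !addr0 add0r.
Qed.

(** Sylvester's argument: X also intertwines the products of factors for rs', so the product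
    at A kills X, and each of its factors A - r is injective because r is not in rs. *)
Lemma sylvester0 m n rs rs' (A : 'M[R]_m) (B : 'M[R]_n) (X : 'M_(m, n)) :
  root_prod rs A = 0 -> root_prod rs' B = 0 -> {in rs', forall r, r \notin rs} ->
  A *m X = X *m B -> X = 0.
Proof.
move=> A0 B0 dis AX.
have inj r (Y : 'M_(m, n)) : r \notin rs -> (A - r%:M) *m Y = 0 -> Y = 0.
  move=> rrs AY; have {}AY : A *m Y = r *: Y.
    by apply/eqP; rewrite -subr_eq0 -mul_scalar_mx -mulmxBl AY.
  have : root_prod rs A *m Y = (\prod_(s <- rs) (r - s)) *: Y.
    elim: (rs) => [|s ss IH] /=; first by rewrite big_nil mul1mx scale1r.
    rewrite -mulmxA IH big_cons -scalemxAr mulmxBl AY mul_scalar_mx -scalerBl scalerA.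
    by rewrite mulrC.
  rewrite A0 mul0mx => /esym/eqP; rewrite scaler_eq0 => /orP[|/eqP//].
  rewrite prodf_seq_eq0 => /hasP[s srs /=]; rewrite subr_eq0 => /eqP rs_eq.
  by rewrite rs_eq srs in rrs.
have XB : root_prod rs' A *m X = 0.
  rewrite -[RHS](mulmx0 _ X) -B0.
  elim: {dis B0} rs' => [|r ss IH] /=; first by rewrite mul1mx mulmx1.
  by rewrite -mulmxA IH !mulmxA mulmxBl mulmxBr AX scalar_mxC.
elim: rs' dis XB {B0} => [|r ss IH] /= dis; first by rewrite mul1mx.
rewrite -mulmxA => /inj XB; apply: IH => [s sss|]; first by rewrite dis// inE sss orbT.
by apply: XB; rewrite dis ?mem_head.
Qed.

Lemma num_eigenvalues_le n rs (A : 'M[R]_n) :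
  root_prod rs A = 0 -> (num_eigenvalues A <= size rs)%N.
Proof.
move=> A0; have sub : ([set a | eigenvalue A a] `<=` [set` rs])%classic.
  move=> a /= /eigenvalueP[v vA v0].
  have : v *m root_prod rs A = (\prod_(s <- rs) (a - s)) *: v.
    elim: (rs) => [|s ss IH] /=; first by rewrite big_nil mulmx1 scale1r.
    by rewrite mulmxA mulmxBr vA mul_mx_scalar -scalerBl -scalemxAl IH scalerA big_cons.
  rewrite A0 mulmx0 => /esym/eqP; rewrite scaler_eq0 (negbTE v0) orbF.
  by rewrite prodf_seq_eq0 => /hasP[s srs /= ]; rewrite subr_eq0 => /eqP->.
have fin : finite_set [set` rs]%classic by [].
have fsub : (fset_set [set a | eigenvalue A a]%classic `<=` [fset x in rs])%fset.
  apply/fsubsetP => a; rewrite in_fset_set; last exact: sub_finite_set sub fin.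
  by rewrite inE => /sub /= ars; rewrite !inE.
rewrite /num_eigenvalues; apply: leq_trans (fsubset_leq_card fsub) _.
by rewrite card_fseq size_undup.
Qed.

End RootProduct.

Section Bounds.
Variable R : realType.

Definition spectral_bound n (e : rel 'I_n) c := exists (A : 'M[R]_n) rs,
  [/\ A^T = A, forall i j, i != j -> (A i j != 0) = e i j,
      root_prod rs A = 0 & size rs = c].

Lemma q_le n (G : sgraph n) c : spectral_bound G c -> (q R G <= c)%N.
Proof.
move=> [A [rs [As AG A0 <-]]]; rewrite /q; case: ex_minnP => k _ kmin.
apply: leq_trans (num_eigenvalues_le A0); apply: kmin; apply/asboolP.
by exists A.
Qed.

(** Graphs are relations on all natural numbers, restricted to the first n of them: direct
    sums then act on the indices by mere shifts. *)
Definition ssp_bound n (e : rel nat) c := exists (A : 'M[R]_n) rs,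
  [/\ A^T = A, ssp A, forall i j, i != j -> A i j != 0 -> e i j,
      root_prod rs A = 0 & size rs = c].

Lemma ssp_bound_spectral n (e : rel nat) c : symmetric e ->
  ssp_bound n e c -> spectral_bound (fun i j : 'I_n => e i j) c.
Proof.
move=> es [A [rs [As Assp Ae A0 <-]]].
have [||B [Bs Be B0]] := @ssp_supergraph _ _ rs A (fun i j => e i j) As Assp _ _ A0.
- by move=> i j; exact: es.
- by [].
by exists B, rs.
Qed.

Lemma ssp_shift n t (A : 'M[R]_n) : ssp A -> ssp (A + t%:M).
Proof.
move=> Assp X Xs XA AX; apply: Assp => // [i j Aij|].
  apply: XA; move: Aij; rewrite /mx_pattern !mxE; case: eqP => //= _.
  by rewrite mulr0n addr0.
by move: AX; rewrite mulmxDl mulmxDr scalar_mxC => /addIr.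
Qed.

(** A symmetric matrix commuting with the direct sum has off-diagonal blocks that
    intertwine A and B, so they vanish, and the diagonal blocks commute with A and B. *)
Lemma ssp_block m n rs rs' (A : 'M[R]_m) (B : 'M[R]_n) :
  root_prod rs A = 0 -> root_prod rs' B = 0 -> {in rs', forall r, r \notin rs} ->
  ssp A -> ssp B -> ssp (block_mx A 0 0 B).
Proof.
move=> A0 B0 dis Assp Bssp X Xs XA.
rewrite -[X]submxK in Xs *; set X1 := ulsubmx X in Xs *; set X2 := ursubmx X in Xs *.
set X3 := dlsubmx X in Xs *; set X4 := drsubmx X in Xs *.
rewrite !mulmx_block !mul0mx !mulmx0 !addr0 !add0r => /eq_block_mx[AX1 AX2 _ BX4].
move: Xs; rewrite tr_block_mx => /eq_block_mx[X1s X32 _ X4s].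
have X20 : X2 = 0 by exact: sylvester0 A0 B0 dis AX2.
have X30 : X3 = 0 by rewrite -[X3]trmxK X32 X20 trmx0.
have X10 : X1 = 0.
  apply: Assp => // i j Aij; rewrite !mxE; apply: XA; move: Aij.
  by rewrite /mx_pattern (inj_eq (@lshift_inj _ _)) block_mxEul.
have X40 : X4 = 0.
  apply: Bssp => // i j ijB; rewrite !mxE; apply: XA; move: ijB.
  by rewrite /mx_pattern (inj_eq (@rshift_inj _ _)) block_mxEdr.
by rewrite X10 X20 X30 X40 block_mx0.
Qed.

Lemma exists_disjoint_shift (rs rs' : seq R) :
  exists t, {in [seq r + t | r <- rs'], forall r, r \notin rs}.
Proof.
have le_sum (s : seq R) x : x \in s -> `|x| <= \sum_(y <- s) `|y|.
  by move=> xs; rewrite (big_rem x)//= lerDl sumr_ge0.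
exists (\sum_(s <- rs) `|s| + \sum_(s <- rs') `|s| + 1) => _ /mapP[r rrs ->].
apply/negP => /le_sum; have := le_sum _ _ rrs.
set S := \sum_(s <- rs) _; set S' := \sum_(s <- rs') _ => rS' rS.
have := ler_norm (r + (S + S' + 1)); have := ler_norm (- r); rewrite normrN; lra.
Qed.

Lemma ssp_bound_add m n e c c' : ssp_bound m e c ->
  ssp_bound n (fun i j => e (m + i)%N (m + j)%N) c' -> ssp_bound (m + n) e (c + c').
Proof.
move=> [A [rs [As Assp Ae A0 <-]]] [B [rs' [Bs Bssp Be B0 <-]]].
have [t dis] := exists_disjoint_shift rs rs'.
have B1 : root_prod [seq r + t | r <- rs'] (B + t%:M) = 0 by rewrite root_prod_shift.
exists (block_mx A 0 0 (B + t%:M)), (rs ++ [seq r + t | r <- rs']); split.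
- by rewrite tr_block_mx !trmx0 As linearD /= Bs tr_scalar_mx.
- exact: ssp_block A0 B1 dis Assp (ssp_shift (t := t) Bssp).
- move=> i j; case: (split_ordP i) => {}i ->; case: (split_ordP j) => {}j ->.
  + by rewrite (inj_eq (@lshift_inj _ _)) block_mxEul; exact: Ae.
  + by rewrite block_mxEur mxE eqxx.
  + by rewrite block_mxEdl mxE eqxx.
  + rewrite (inj_eq (@rshift_inj _ _)) block_mxEdr => ij.
    by rewrite !mxE (negbTE ij) mulr0n addr0; exact: Be.
- by rewrite root_prod_cat !root_prod_block A0 B1 mulmx_block !(mul0mx, mulmx0) !addr0 block_mx0.
- by rewrite size_cat size_map.
Qed.

Lemma ssp_bound_isolated n e : ssp_bound n e n.
Proof.
elim: n e => [|n IH] e.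
  exists 0, [::]; split=> //; [exact: trmx0|by move=> X *; apply: flatmx0|by case|].
  by rewrite [LHS]flatmx0.
rewrite -[n.+1]add1n; apply: ssp_bound_add; last exact: IH.
exists 0, [:: 0]; split=> //.
- exact: trmx0.
- move=> X _ X0 _; apply/matrixP => i j; rewrite X0 ?mxE// /mx_pattern.
  by rewrite !ord1 eqxx.
- by move=> i j; rewrite !ord1 eqxx.
- by rewrite /= raddf0 subr0 mul0mx.
Qed.

End Bounds.

(** * Deciding the strong spectral property of integer matrices *)

Definition index_pairs n := [seq (i, j) | i <- iota 0 n, j <- iota 0 n].

Section Elimination.
Variable K : idomainType.

(** Fraction-free, so that integers suffice; rows without the first unknown are not scaled,
    which keeps the coefficients short. *)
Definition eliminate m (pivot row : seq K) : seq K :=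
  if head 0 row == 0 then behead row
  else mkseq (fun i => head 0 pivot * row`_i.+1 - head 0 row * pivot`_i.+1) m.

Fixpoint only_zero_solution m (rows : seq (seq K)) : bool :=
  if m is m'.+1 then
    if [seq r <- rows | head 0 r != 0] is pivot :: _ then
      only_zero_solution m' [seq eliminate m' pivot r | r <- rows]
    else false
  else true.

Lemma only_zero_solutionP (L : idomainType) (f : {rmorphism K -> L}) m rows (v : nat -> L) :
  injective f -> only_zero_solution m rows ->
  (forall r, r \in rows -> \sum_(i < m) f r`_i * v i = 0) ->
  forall i, (i < m)%N -> v i = 0.
Proof.
move=> f_inj; elim: m rows v => [|m IH] rows v //=.
case E: [seq r <- rows | _] => [//|p ps] ok vrows.
have : p \in [seq r <- rows | head 0 r != 0] by rewrite E mem_head.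
rewrite mem_filter => /andP[p0 pin].
have row0 r : r \in rows -> \sum_(i < m) f r`_i.+1 * v i.+1 = - (f (head 0 r) * v 0%N).
  move=> rin; have := vrows r rin; rewrite big_ord_recl /= nth0 => /eqP.
  by rewrite addrC addr_eq0 => /eqP.
have vS i : (i < m)%N -> v i.+1 = 0.
  apply: (IH _ (fun i => v i.+1) ok) => _ /mapP[r rin ->].
  rewrite /eliminate; have [h0|h0] := eqVneq.
    rewrite (eq_bigr (fun k : 'I_m => f r`_k.+1 * v k.+1)); last by move=> k _; rewrite nth_behead.
    by rewrite row0// h0 rmorph0 mul0r oppr0.
  transitivity (\sum_(i < m) (f (head 0 p) * (f r`_i.+1 * v i.+1)
                             - f (head 0 r) * (f p`_i.+1 * v i.+1))).
    apply: eq_bigr => k _; rewrite nth_mkseq// rmorphB !rmorphM; ring.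
  by rewrite sumrB -!mulr_sumr !row0//; ring.
case=> [_|i]; last exact: vS.
have := row0 p pin; rewrite big1; last by move=> i _; rewrite vS ?mulr0.
move/esym/eqP; rewrite oppr_eq0 mulf_eq0 => /orP[|/eqP//].
by rewrite -(rmorph0 f) (inj_eq f_inj) (negbTE p0).
Qed.

End Elimination.

Section IntegerMatrices.
Implicit Types s t : seq (seq Z).

Definition entry s i j : Z := (nth [::] s i)`_j.

Definition zsum n (F : nat -> Z) : Z := foldr (fun k a => F k + a) 0 (iota 0 n).

Definition tabulate n (F : nat -> nat -> Z) := mkseq (fun i => mkseq (F i) n) n.

Definition zmul n s t := tabulate n (fun i j => zsum n (fun k => entry s i k * entry t k j)).

Definition zroot_prod n rs s := foldr
  (fun r t => zmul n (tabulate n (fun i j => entry s i j - r *+ (i == j))) t)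
  (tabulate n (fun i j => (i == j)%:R)) rs.

Definition annihilates n rs s :=
  all (fun p => entry (zroot_prod n rs s) p.1 p.2 == 0) (index_pairs n).

Definition zsym n s := all (fun p => entry s p.1 p.2 == entry s p.2 p.1) (index_pairs n).

(** The unknowns are the entries X_u at the off-diagonal zeros u of A; the equations say
    that X is symmetric and commutes with A. *)
Definition ssp_unknowns n s :=
  [seq u <- index_pairs n | (u.1 != u.2) && (entry s u.1 u.2 == 0)].

Definition ssp_equations n s : seq (seq Z) :=
  [seq [seq (u == p)%:R - (u == (p.2, p.1))%:R | u <- ssp_unknowns n s] | p <- ssp_unknowns n s]
  ++ [seq [seq entry s p.1 u.1 *+ (u.2 == p.2) - entry s u.2 p.2 *+ (u.1 == p.1)
            | u <- ssp_unknowns n s] | p <- index_pairs n].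

Definition zssp n s := only_zero_solution (size (ssp_unknowns n s)) (ssp_equations n s).

Variable R : realType.

Definition realZ (z : Z) : R := (int_of_Z z)%:~R.

Fact realZ_is_additive : additive realZ.
Proof. by move=> x y; rewrite /realZ rmorphB /= rmorphB. Qed.
HB.instance Definition _ := GRing.isAdditive.Build Z R realZ realZ_is_additive.
Fact realZ_is_multiplicative : multiplicative realZ.
Proof. by split=> [x y|]; rewrite /realZ ?rmorph1// rmorphM /= rmorphM. Qed.
HB.instance Definition _ := GRing.isMultiplicative.Build Z R realZ realZ_is_multiplicative.

Lemma realZ_inj : injective realZ.
Proof. by move=> x y /intr_inj /(can_inj int_of_ZK). Qed.

Definition mxZ n s : 'M[R]_n := \matrix_(i < n, j < n) realZ (entry s i j).

Lemma mem_index_pairs n i j : ((i, j) \in index_pairs n) = (i < n)%N && (j < n)%N.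
Proof.
apply/allpairsP/andP => [[[k l] /=]|[ltin ltjn]].
  by rewrite !mem_iota => -[kn ln [-> ->]].
by exists (i, j); rewrite /= !mem_iota.
Qed.

Lemma zsumE n F : realZ (zsum n F) = \sum_(i < n) realZ (F i).
Proof.
rewrite -(big_mkord xpredT (fun i => realZ (F i))) /zsum /index_iota subn0.
elim: (iota 0 n) => [|k ks IH]; first by rewrite big_nil rmorph0.
by rewrite big_cons -IH -rmorphD.
Qed.

Lemma entry_tabulate n F i j : (i < n)%N -> (j < n)%N -> entry (tabulate n F) i j = F i j.
Proof. by move=> ltin ltjn; rewrite /entry !nth_mkseq. Qed.

Lemma mxZ_tabulate n F : mxZ n (tabulate n F) = \matrix_(i, j) realZ (F i j).
Proof. by apply/matrixP => i j; rewrite !mxE entry_tabulate. Qed.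

Lemma mxZ_mul n s t : mxZ n (zmul n s t) = mxZ n s *m mxZ n t.
Proof.
rewrite mxZ_tabulate; apply/matrixP => i j; rewrite !mxE zsumE.
by apply: eq_bigr => k _; rewrite !mxE rmorphM.
Qed.

Lemma mxZ_root_prod n rs s :
  mxZ n (zroot_prod n rs s) = root_prod [seq realZ r | r <- rs] (mxZ n s).
Proof.
elim: rs => [|r rs IH] /=.
  by rewrite mxZ_tabulate; apply/matrixP => i j; rewrite !mxE rmorph_nat.
rewrite mxZ_mul IH; congr (_ *m _); rewrite mxZ_tabulate.
by apply/matrixP => i j; rewrite !mxE rmorphB rmorphMn.
Qed.

Lemma annihilatesP n rs s : annihilates n rs s ->
  root_prod [seq realZ r | r <- rs] (mxZ n s) = 0.
Proof.
move=> /allP z; rewrite -mxZ_root_prod; apply/matrixP => i j; rewrite !mxE.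
by rewrite (eqP (z (val i, val j) _)) ?rmorph0// mem_index_pairs !ltn_ord.
Qed.

Lemma zsymP n s : zsym n s -> (mxZ n s)^T = mxZ n s.
Proof.
move=> /allP z; apply/matrixP => i j; rewrite !mxE; congr realZ; apply/eqP.
by rewrite (z (val j, val i))// mem_index_pairs !ltn_ord.
Qed.

Lemma mxZ_neq0 n s (i j : 'I_n) : (mxZ n s i j != 0) = (entry s i j != 0).
Proof. by rewrite mxE -(rmorph0 realZ) (inj_eq realZ_inj). Qed.

Lemma sum_index_pairs n (F : nat * nat -> R) :
  \sum_(u <- index_pairs n) F u = \sum_(k < n) \sum_(l < n) F (val k, val l).
Proof.
have iotaE G : \sum_(k <- iota 0 n) G k = \sum_(k < n) G (val k) :> R.
  by rewrite -(big_mkord xpredT G) /index_iota subn0.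
by rewrite big_allpairs_dep /= iotaE; apply: eq_bigr => k _; exact: iotaE.
Qed.

(** A symmetric X that vanishes on the pattern is determined by the unknowns, and its
    commutation with A is the system of equations. *)
Lemma zsspP n s : zssp n s -> ssp (mxZ n s).
Proof.
move=> sspn X Xs X0 AX; pose us := ssp_unknowns n s.
pose x (u : nat * nat) := oapp (fun i => oapp (X i) 0 (insub u.2)) 0 (insub u.1).
have xX (i j : 'I_n) : x (val i, val j) = X i j by rewrite /x !valK.
have x0 (i j : 'I_n) : (val i, val j) \notin us -> X i j = 0.
  rewrite mem_filter mem_index_pairs !ltn_ord !andbT /= => nij; apply: X0.
  by move: nij; rewrite /mx_pattern mxZ_neq0 negb_and negbK -val_eqE.
have sum_us (F : nat * nat -> R) : \sum_(u <- us) F u * x u =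
    \sum_(k < n) \sum_(l < n) F (val k, val l) * X k l.
  rewrite big_filter big_mkcond sum_index_pairs; apply: eq_bigr => k _; apply: eq_bigr => l _.
  case: ifPn => [_|nkl]; first by rewrite xX.
  by rewrite x0 ?mulr0// mem_filter negb_and nkl.
pose v i := x (nth (0, 0)%N us i).
have dot (F : nat * nat -> Z) :
    \sum_(i < size us) realZ [seq F u | u <- us]`_i * v i = \sum_(u <- us) realZ (F u) * x u.
  rewrite [RHS](big_nth (0, 0)%N) big_mkord; apply: eq_bigr => i _.
  by rewrite (nth_map (0, 0)%N).
have v0 i : (i < size us)%N -> v i = 0.
  apply: (only_zero_solutionP (f := realZ) realZ_inj sspn) => r.
  rewrite mem_cat => /orP[] /mapP[[a b] pin ->]; rewrite dot sum_us /=.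
    have := pin; rewrite mem_filter mem_index_pairs => /and3P[_ an bn].
    pose i' := Ordinal an; pose j' := Ordinal bn.
    have pick (k l : 'I_n) :
        \sum_(c < n) \sum_(d < n) realZ ((val c, val d) == (val k, val l))%:R * X c d = X k l.
      rewrite (bigD1 k)//= (bigD1 l)//= eqxx rmorph1 mul1r big1 => [|d dl]; last first.
        by rewrite xpair_eqE !val_eqE (negbTE dl) andbF rmorph0 mul0r.
      rewrite addr0 big1 ?addr0// => c ck; rewrite big1// => d _.
      by rewrite xpair_eqE !val_eqE (negbTE ck) rmorph0 mul0r.
    transitivity (X i' j' - X j' i'); last by rewrite -{1}Xs mxE subrr.
    rewrite -[in RHS](pick i' j') -[in RHS](pick j' i') -sumrB; apply: eq_bigr => k _.
    by rewrite -sumrB; apply: eq_bigr => l _; rewrite rmorphB mulrBl.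
  move: pin; rewrite mem_index_pairs => /andP[an bn].
  pose i' := Ordinal an; pose j' := Ordinal bn.
  transitivity ((mxZ n s *m X) i' j' - (X *m mxZ n s) i' j'); last by rewrite AX subrr.
  rewrite (eq_bigr (fun k : 'I_n => (\sum_(l < n) realZ (entry s a k *+ (val l == b)) * X k l)
      - \sum_(l < n) realZ (entry s l b *+ (val k == a)) * X k l)); last first.
    by move=> k _; rewrite -sumrB; apply: eq_bigr => l _; rewrite rmorphB mulrBl.
  rewrite sumrB; congr (_ - _).
    rewrite mxE; apply: eq_bigr => k _; rewrite (bigD1 j')//= eqxx big1 ?addr0 ?mxE// => l lj.
    by rewrite -[b]/(val j') val_eqE (negbTE lj) mulr0n rmorph0 mul0r.
  rewrite (bigD1 i')//= [X in _ + X]big1 ?addr0 => [|k ki]; last first.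
    by apply: big1 => l _; rewrite -[a]/(val i') val_eqE (negbTE ki) mulr0n rmorph0 mul0r.
  by rewrite mxE; apply: eq_bigr => l _; rewrite eqxx mxE mulrC.
apply/matrixP => i j; rewrite mxE.
have [uin|] := boolP ((val i, val j) \in us); last exact: x0.
have := v0 (index (val i, val j) us); rewrite /v nth_index// index_mem xX; exact.
Qed.
End IntegerMatrices.

(** * Small models and packings *)

Definition edge (E : seq (nat * nat)) (i j : nat) := ((i, j) \in E) || ((j, i) \in E).

Lemma edgeC E i j : edge E i j = edge E j i.
Proof. by rewrite /edge orbC. Qed.

(** The roots need not be exactly the eigenvalues: the product of the factors x - r has to
    annihilate the matrix. *)
Record model := Model {
  model_size : nat;
  model_mx : seq (seq Z);
  model_roots : seq Z
}.

Definition model_edges T := [seq p <- index_pairs (model_size T) |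
  (p.1 < p.2)%N && (entry (model_mx T) p.1 p.2 != 0)].

Definition spectral_model T := zsym (model_size T) (model_mx T) &&
  annihilates (model_size T) (model_roots T) (model_mx T).

Definition ssp_model T := spectral_model T && zssp (model_size T) (model_mx T).

Definition gram (u : seq (seq Z)) :=
  [seq [seq foldr +%R 0 [seq p.1 * p.2 | p <- zip v w] | w <- u] | v <- u].

(** If the matrix U with rows u satisfies U^T U = N, then (U U^T)^2 = N U U^T. *)
Definition frame_model u N := Model (size u) (gram u) [:: 0; N].

Local Open Scope Z_scope.

(** The matrix of C6 is 3-periodic up to a sign, which makes each eigenvalue double. *)
Definition models := [::
  (* K3 *) frame_model [:: [:: 1]; [:: 1]; [:: 1]] 3;
  (* C4 *) frame_model [:: [:: 1; 0]; [:: 1; 2]; [:: 0; 1]; [:: -2; 1]] 6;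
  (* K_{1,3} *)
  Model 4 [:: [:: 0; 1; 2; 2]; [:: 1; 0; 0; 0]; [:: 2; 0; 0; 0]; [:: 2; 0; 0; 0]] [:: 0; 3; -3];
  (* C5 *)
  Model 5 [:: [:: 23; 4; 0; 0; 4]; [:: 4; 0; 12; 0; 0]; [:: 0; 12; 8; 1; 0];
              [:: 0; 0; 1; 8; 12]; [:: 4; 0; 0; 12; 0]] [:: 25; 16; -9];
  (* C6 *)
  Model 6 [:: [:: 0; 1; 0; 0; 0; -2]; [:: 1; 0; 2; 0; 0; 0]; [:: 0; 2; 0; 2; 0; 0];
              [:: 0; 0; 2; 0; 1; 0]; [:: 0; 0; 0; 1; 0; 2]; [:: -2; 0; 0; 0; 2; 0]] [:: 0; 3; -3];
  (* K_{2,3} with an edge added *)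
  frame_model [:: [:: 5; 0]; [:: 1; 1]; [:: -1; 1]; [:: 0; 3]; [:: 0; 4]] 27;
  (* the triangular prism *)
  frame_model [:: [:: 1; 1; 0]; [:: 1; 0; 1]; [:: 0; 1; 1];
                  [:: 1; 1; -1]; [:: 1; -1; 1]; [:: -1; 1; 1]] 5;
  (* the complement of a 7-cycle with a chord that cuts off a triangle *)
  frame_model [:: [:: 74; 0; 0]; [:: 0; 24; 0]; [:: 0; 0; 26]; [:: 120; 20; 0];
                  [:: -10; 60; 105]; [:: 15; -120; 70]; [:: 0; 35; 60]] 20201;
  (* K1 *) Model 1 [:: [:: 0]] [:: 0]].

(** Matrices without the strong spectral property: they only serve the graph that they
    carry. The eigenvalue of the isolated vertex of P_k + K_1 is an eigenvalue of the path;
    in the last graph each pair of twin leaves contributes to the kernel. *)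
Definition rigid_models := [::
  (* P2 + K1 *)
  Model 3 [:: [:: 0; 1; 0]; [:: 1; 0; 0]; [:: 0; 0; 1]] [:: 1; -1];
  (* P3 + K1 *)
  Model 4 [:: [:: 0; 3; 0; 0]; [:: 3; 0; 4; 0]; [:: 0; 4; 0; 0]; [:: 0; 0; 0; 0]] [:: 0; 5; -5];
  (* P4 + K1 *)
  Model 5 [:: [:: 0; 2; 0; 0; 0]; [:: 2; 0; 3; 0; 0]; [:: 0; 3; 0; 2; 0];
              [:: 0; 0; 2; 0; 0]; [:: 0; 0; 0; 0; 1]] [:: 1; -1; 4; -4];
  (* a triangle with two leaves attached to each of two of its vertices *)
  Model 7 [:: [:: 0; 0; 0; 0; 0; 0; 1]; [:: 0; 0; 0; 0; 0; 0; 1]; [:: 0; 0; 0; 0; 0; 1; 0];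
              [:: 0; 0; 0; 0; 0; 1; 0]; [:: 0; 0; 0; 0; 0; 3; 3]; [:: 0; 0; 1; 1; 3; 0; 1];
              [:: 1; 1; 0; 0; 3; 1; 0]] [:: 0; 1; -2; 5; -4]].

Local Close Scope Z_scope.

Lemma models_ssp : all ssp_model models.
Proof. by vm_compute. Qed.

Lemma rigid_models_spectral : all spectral_model rigid_models.
Proof. by vm_compute. Qed.

Section Packings.
Variable R : realType.

Lemma mem_model_edges T i j : (i < j < model_size T)%N ->
  ((i, j) \in model_edges T) = (entry (model_mx T) i j != 0).
Proof.
case/andP=> ltij ltjn; rewrite mem_filter mem_index_pairs /= ltij ltjn.
by rewrite (ltn_trans ltij ltjn) !andbT.
Qed.

Lemma model_edgesP T (i j : 'I_(model_size T)) : spectral_model T -> i != j ->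
  (mxZ R (model_size T) (model_mx T) i j != 0) = edge (model_edges T) i j.
Proof.
case/andP=> /zsymP sym _; wlog ltij : i j / (i < j)%N => [hw ij|_].
  have [/hw->//|ltji|/val_inj/eqP] := ltngtP i j; last by rewrite (negbTE ij).
  by rewrite -sym mxE hw// 1?eq_sym// /edge orbC.
rewrite mxZ_neq0 /edge mem_model_edges ?ltij ?ltn_ord//.
suff /negbTE-> : (val j, val i) \notin model_edges T by rewrite orbF.
by rewrite mem_filter negb_and negb_and -leqNgt /= (ltnW ltij).
Qed.

Lemma ssp_model_bound T (e : rel nat) : ssp_model T -> symmetric e ->
  all (fun p => e p.1 p.2) (model_edges T) ->
  ssp_bound R (model_size T) e (size (model_roots T)).
Proof.
case/andP=> Tspec Tssp es /allP eT.
have [sym ann] := andP Tspec.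
exists (mxZ R _ (model_mx T)), [seq realZ R r | r <- model_roots T]; split.
- exact: zsymP.
- exact: zsspP.
- by move=> i j ij; rewrite model_edgesP// => /orP[] /eT//=; rewrite es.
- exact: annihilatesP.
- by rewrite size_map.
Qed.

Lemma spectral_model_bound T : spectral_model T ->
  spectral_bound R (fun i j : 'I_(model_size T) => edge (model_edges T) i j)
    (size (model_roots T)).
Proof.
move=> Tspec; have [sym ann] := andP Tspec.
exists (mxZ R _ (model_mx T)), [seq realZ R r | r <- model_roots T]; split.
- exact: zsymP.
- by move=> i j ij; exact: model_edgesP.
- exact: annihilatesP.
- by rewrite size_map.
Qed.

Lemma ssp_bound_sub n (e e' : rel nat) c :
  (forall i j, (i < n)%N -> (j < n)%N -> e i j -> e' i j) ->
  ssp_bound R n e c -> ssp_bound R n e' c.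
Proof.
move=> ee' [A [rs [As Assp Ae A0 src]]]; exists A, rs; split=> // i j ij Aij.
by apply: ee' => //; exact: Ae.
Qed.

Definition relabel (e : rel nat) (us : seq nat) : rel nat :=
  fun i j => e (nth 0%N us i) (nth 0%N us j).

(** Piece (k, vs) is a copy of the k-th model on the vertices vs. *)
Definition piece_in (e : rel nat) (p : nat * seq nat) :=
  let T := nth (Model 0 [::] [::]) models p.1 in
  [&& (p.1 < size models)%N, size p.2 == model_size T &
      all (fun a => relabel e p.2 a.1 a.2) (model_edges T)].

Definition piece_cost (p : nat * seq nat) :=
  size (model_roots (nth (Model 0 [::] [::]) models p.1)).

(** Each vertex of [rest] is a summand K1, hence costs one eigenvalue. *)
Lemma ssp_bound_packing (e : rel nat) ps rest : symmetric e -> all (piece_in e) ps ->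
  let us := flatten [seq p.2 | p <- ps] ++ rest in
  ssp_bound R (size us) (relabel e us) (sumn [seq piece_cost p | p <- ps] + size rest).
Proof.
move=> es; elim: ps => [_|[k vs] ps IH] /=; first exact: ssp_bound_isolated.
case/andP=> /and3P[/= ltk /eqP sz /allP kin] /IH IH'; rewrite -catA size_cat -addnA.
have Tssp := all_nthP (Model 0 [::] [::]) models_ssp _ ltk.
set T := nth _ _ _ in sz kin Tssp.
apply: ssp_bound_add; last first.
  apply: ssp_bound_sub IH' => i j _ _; rewrite /relabel !nth_cat.
  by rewrite ![(size vs + _ < _)%N]ltnNge !leq_addr /= !addKn.
rewrite sz; apply: ssp_model_bound => //; first by move=> i j; exact: es.
apply/allP => -[i j] ijT; have := kin _ ijT; move: ijT.
rewrite mem_filter mem_index_pairs => /and3P[_ ltin ltjn].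
by rewrite /relabel !nth_cat sz ltin ltjn.
Qed.

Lemma root_prod_mxsub n rs (A : 'M[R]_n) (g : 'I_n -> 'I_n) : bijective g ->
  root_prod rs (mxsub g g A) = mxsub g g (root_prod rs A).
Proof.
move=> gb; elim: rs => [|r rs /= ->] /=.
  by apply/matrixP => i j; rewrite !mxE (inj_eq (bij_inj gb)).
apply/matrixP => i j; rewrite !mxE [RHS](reindex g) /=; last exact: onW_bij.
by apply: eq_bigr => k _; rewrite !mxE (inj_eq (bij_inj gb)).
Qed.

Lemma spectral_bound_ext n (e e' : rel 'I_n) c :
  (forall i j, i != j -> e i j = e' i j) -> spectral_bound R e c -> spectral_bound R e' c.
Proof.
by move=> ee' [A [rs [As Ae A0 src]]]; exists A, rs; split=> // i j ij; rewrite Ae// ee'.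
Qed.

Lemma spectral_bound_relabel n (e : rel nat) us c : perm_eq us (iota 0 n) ->
  spectral_bound R (fun i j : 'I_n => relabel e us i j) c ->
  spectral_bound R (fun i j : 'I_n => e i j) c.
Proof.
move=> pus [A [rs [As Ae A0 src]]].
have szus : size us = n by rewrite (perm_size pus) size_iota.
have inus (i : 'I_n) : val i \in us by rewrite (perm_mem pus) mem_iota add0n ltn_ord.
have lt_index (i : 'I_n) : (index (val i) us < n)%N by have := inus i; rewrite -index_mem szus.
pose g i : 'I_n := Ordinal (lt_index i).
have g_inj : injective g.
  by move=> i j [/(congr1 (nth 0%N us))]; rewrite !nth_index ?inus// => /val_inj.
exists (mxsub g g A), rs; split=> //.
- by apply/matrixP => i j; rewrite !mxE -{2}As mxE.
- move=> i j ij; rewrite mxE Ae ?(inj_eq g_inj)//.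
  by rewrite /relabel /= !nth_index ?inus.
- by rewrite root_prod_mxsub ?A0; [apply/matrixP => i j; rewrite !mxE | exact: injF_bij].
Qed.

Definition packing_in n (e : rel nat) ps := let vs := flatten [seq p.2 | p <- ps] in
  [&& uniq vs, all (fun v => (v < n)%N) vs & all (piece_in e) ps].

Definition packing_cost n ps :=
  (sumn [seq piece_cost p | p <- ps] + (n - size (flatten [seq p.2 | p <- ps])))%N.

Lemma spectral_bound_packing n (e : rel nat) ps : symmetric e -> packing_in n e ps ->
  spectral_bound R (fun i j : 'I_n => e i j) (packing_cost n ps).
Proof.
move=> es /and3P[uvs /allP vsn psin]; set vs := flatten _ in uvs vsn.
pose rest := [seq v <- iota 0 n | v \notin vs].
have pus : perm_eq (vs ++ rest) (iota 0 n).
  apply: uniq_perm; rewrite ?iota_uniq// ?cat_uniq ?uvs ?filter_uniq ?iota_uniq//=.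
    by rewrite andbT; apply/hasPn => v; rewrite mem_filter => /andP[].
  move=> v; rewrite mem_cat mem_filter mem_iota add0n.
  by have [/vsn->|] := boolP (v \in vs).
have szus : size (vs ++ rest) = n by rewrite (perm_size pus) size_iota.
have bnd := ssp_bound_packing rest es psin; cbv zeta in bnd; rewrite -/vs szus in bnd.
have -> : packing_cost n ps = (sumn [seq piece_cost p | p <- ps] + size rest)%N.
  by rewrite /packing_cost -/vs -[n in (n - _)%N]szus size_cat addKn.
apply: (spectral_bound_relabel pus); apply: ssp_bound_spectral => //.
by move=> i j; exact: es.
Qed.

End Packings.

(** * Case analysis on edges up to isomorphism and complement *)

(** Vertices are single digits, so lists of vertices are written as numerals, which may
    begin with 0. *)
Fixpoint digits_of (u : Decimal.uint) : seq nat :=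
  match u with
  | Decimal.Nil => [::]
  | Decimal.D0 u => 0 :: digits_of u | Decimal.D1 u => 1 :: digits_of u
  | Decimal.D2 u => 2 :: digits_of u | Decimal.D3 u => 3 :: digits_of u
  | Decimal.D4 u => 4 :: digits_of u | Decimal.D5 u => 5 :: digits_of u
  | Decimal.D6 u => 6 :: digits_of u | Decimal.D7 u => 7 :: digits_of u
  | Decimal.D8 u => 8 :: digits_of u | Decimal.D9 u => 9 :: digits_of u
  end%N.

Definition digits (u : Number.uint) :=
  if u is Number.UIntDecimal u then digits_of u else [::].

Fixpoint digit_pairs (s : seq nat) : seq (nat * nat) :=
  if s is i :: j :: s' then (i, j) :: digit_pairs s' else [::].

Definition model_sizes := [seq model_size T | T <- models].

(** A packing is written as the concatenation of its pieces: the index of a model followed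
    by the vertices of the copy. The index 8 of K1 gives a way of writing packings without
    any useful piece, as 80. *)
Fixpoint parse_packing fuel (s : seq nat) : seq (nat * seq nat) :=
  if fuel is fuel'.+1 then
    if s is k :: s' then
      let m := nth 0%N model_sizes k in
      (k, take m s') :: parse_packing fuel' (drop m s')
    else [::]
  else [::].

Definition packing (u : Number.uint) := let s := digits u in parse_packing (size s) s.

(** Proofs of the bound for the graphs with given known edges and non-edges:
    - [Pack g h]: the packings g of the known edges and h of the known non-edges;
    - [Rigid k u h]: the graph is the k-th rigid model with its vertices listed by u, and h is
      a packing of the known non-edges;
    - [Excl k u]: the graph is the k-th exception with its vertices listed by u;
    - [Split ij t1 t0]: t1 if ij is an edge, t0 otherwise;
    - [Case k u]: the vertices listed by u carry all that the k-th earlier case requires;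
    - [Dual t]: t is a proof for the complement. *)
Inductive proof_tree :=
  | Pack of Number.uint & Number.uint
  | Rigid of nat & Number.uint & Number.uint
  | Excl of nat & Number.uint
  | Split of Number.uint & proof_tree & proof_tree
  | Case of nat & Number.uint
  | Dual of proof_tree.

Definition partial_graph := (seq (nat * nat) * seq (nat * nat))%type.

Definition partial_of l (E : seq (nat * nat)) : partial_graph :=
  (E, [seq p <- index_pairs l | (p.1 < p.2)%N && ~~ edge E p.1 p.2]).

(** P4, P5, the complement of P5 and T22. *)
Definition exceptions : seq (nat * seq (nat * nat)) := [::
  (4, [:: (0, 1); (1, 2); (2, 3)]);
  (5, [:: (0, 1); (1, 2); (2, 3); (3, 4)]);
  (5, [:: (0, 2); (0, 3); (0, 4); (1, 3); (1, 4); (2, 4)]);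
  (5, [:: (0, 1); (1, 2); (2, 3); (3, 4); (1, 3)])]%N.

Definition rigid_table := [seq ((model_size T, model_edges T), size (model_roots T)) | T <- rigid_models].

Definition refines (st st' : partial_graph) us :=
  all (fun p => edge st.1 (nth 0%N us p.1) (nth 0%N us p.2)) st'.1 &&
  all (fun p => edge st.2 (nth 0%N us p.1) (nth 0%N us p.2)) st'.2.

Fixpoint check n (known : seq partial_graph) (st : partial_graph) t :=
  match t with
  | Pack g h =>
      [&& packing_in n (edge st.1) (packing g), packing_in n (edge st.2) (packing h) &
          (packing_cost n (packing g) + packing_cost n (packing h) <= n + 2)%N]
  | Rigid k u h =>
      let: ((m, E), c) := nth (0%N, [::], 0%N) rigid_table k in
      [&& (k < size rigid_models)%N, m == n, perm_eq (digits u) (iota 0 n),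
          refines st (partial_of n E) (digits u), packing_in n (edge st.2) (packing h) &
          (c + packing_cost n (packing h) <= n + 2)%N]
  | Excl k u =>
      let: (m, E) := nth (0%N, [::]) exceptions k in
      [&& (k < size exceptions)%N, m == n, perm_eq (digits u) (iota 0 n) &
          refines st (partial_of n E) (digits u)]
  | Split ij t1 t0 =>
      if digits ij is [:: i; j] then
        check n known ((i, j) :: st.1, st.2) t1 && check n known (st.1, (i, j) :: st.2) t0
      else false
  | Case k u =>
      [&& (k < size known)%N, perm_eq (digits u) (iota 0 n) &
          refines st (nth ([::], [::]) known k) (digits u)]
  | Dual t => check n known (st.2, st.1) t
  end.

(** Each case (l, u, t) is a graph on the vertices 0, ..., l - 1 with edges u, the
    other vertices being unconstrained; a numeral u of a single digit lists no edge. The tree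
    t may use the cases before it. One case has to be the empty partial graph, which every
    graph realizes. *)
Fixpoint check_cases n known (cases : seq (nat * Number.uint * proof_tree)) :=
  if cases is (l, u, t) :: cases' then
    let st := partial_of l (digit_pairs (digits u)) in
    check n known st t && check_cases n (rcons known st) cases'
  else ([::], [::]) \in known.

Section Soundness.
Variable R : realType.

Definition realizes (e : rel nat) (st : partial_graph) :=
  (forall i j, edge st.1 i j -> e i j) /\ (forall i j, edge st.2 i j -> ~~ e i j).

Definition exceptional n (e : rel nat) := exists k us,
  [/\ (k < size exceptions)%N, (nth (0%N, [::]) exceptions k).1 = n, perm_eq us (iota 0 n) &
      forall i j, (i < n)%N -> (j < n)%N -> i != j ->
        relabel e us i j = edge (nth (0%N, [::]) exceptions k).2 i j].

Definition nordhaus_gaddum n (e : rel nat) := exceptional n e \/ exists c c',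
  [/\ spectral_bound R (fun i j : 'I_n => e i j) c,
      spectral_bound R (fun i j : 'I_n => ~~ e i j) c' & (c + c' <= n + 2)%N].

Lemma packing_in_sub n (e e' : rel nat) ps : (forall i j, e i j -> e' i j) ->
  packing_in n e ps -> packing_in n e' ps.
Proof.
move=> ee' /and3P[uvs vsn psin]; rewrite /packing_in uvs vsn /=.
apply: sub_all psin => p /and3P[pk psz pe]; rewrite /piece_in pk psz /=.
by apply: sub_all pe => a; exact: ee'.
Qed.

Lemma realizes_refines e st st' us : realizes e st -> refines st st' us ->
  symmetric e -> realizes (relabel e us) st'.
Proof.
move=> [e1 e0] /andP[/allP r1 /allP r0] es; split=> i j /orP[ij|ij].
- exact: e1 (r1 _ ij).
- by rewrite /relabel es; exact: e1 (r1 _ ij).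
- exact: e0 (r0 _ ij).
- by rewrite /relabel es; exact: e0 (r0 _ ij).
Qed.

Lemma edge_cons i j E a b : edge ((i, j) :: E) a b =
  [|| (a == i) && (b == j), (a == j) && (b == i) | edge E a b].
Proof. by rewrite /edge !inE !xpair_eqE [(b == i) && _]andbC -!orbA; congr (_ || _); exact: orbCA. Qed.

Lemma edge_partial_of l E i j : (i < l)%N -> (j < l)%N -> i != j -> ~~ edge E i j ->
  edge (partial_of l E).2 i j.
Proof.
move=> ltil ltjl; rewrite neq_ltn => ij nE; rewrite /edge !mem_filter !mem_index_pairs /=.
by rewrite ltil ltjl (edgeC E j i) nE; case/orP: ij => ->; rewrite ?orbT.
Qed.

Lemma realizes_partial_of n e E i j : realizes e (partial_of n E) ->
  (i < n)%N -> (j < n)%N -> i != j -> e i j = edge E i j.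
Proof.
move=> [e1 e0] ltin ltjn ij; have [/e1->//|nE] := boolP (edge E i j).
by apply/negbTE/e0; exact: edge_partial_of.
Qed.

Lemma exceptional_relabel n (e : rel nat) us : perm_eq us (iota 0 n) ->
  exceptional n (relabel e us) -> exceptional n e.
Proof.
move=> pus [k [us' [ltk kn pus' eE]]].
have szus' : size us' = n by rewrite (perm_size pus') size_iota.
have szus : size us = n by rewrite (perm_size pus) size_iota.
exists k, [seq nth 0%N us i | i <- us']; split=> //.
  apply: perm_trans pus; rewrite -{2}(mkseq_nth 0%N us) szus.
  exact: perm_map.
by move=> i j ltin ltjn ij; rewrite -eE// /relabel !(nth_map 0%N) ?szus'.
Qed.

(** The k-th entry is the index of the complement of the k-th exception and an isomorphism:
    P4 and T22 are self-complementary. *)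
Definition exceptions_compl : seq (nat * seq nat) :=
  [:: (0, [:: 2; 0; 3; 1]); (2, [:: 0; 1; 2; 3; 4]);
      (1, [:: 0; 1; 2; 3; 4]); (3, [:: 1; 4; 2; 0; 3])]%N.

Definition exceptions_complP k := let: (k', us) := nth (0%N, [::]) exceptions_compl k in
  let: (n, E) := nth (0%N, [::]) exceptions k in let: (n', E') := nth (0%N, [::]) exceptions k' in
  [&& (k' < size exceptions)%N, n' == n, perm_eq us (iota 0 n) &
    all (fun p => (p.1 != p.2) ==>
      (edge E' p.1 p.2 == ~~ edge E (nth 0%N us p.1) (nth 0%N us p.2))) (index_pairs n)].

Lemma exceptional_compl n (e : rel nat) :
  exceptional n (fun i j => ~~ e i j) -> exceptional n e.
Proof.
move=> [k [vs [ltk kn pvs eE]]].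
have /allP/(_ k) : all exceptions_complP (iota 0 (size exceptions)) by vm_compute.
rewrite mem_iota => /(_ ltk).
rewrite /exceptions_complP; case: (nth _ exceptions_compl k) => k' us.
move: kn eE; case: (nth _ exceptions k) => _ E /= -> eE.
case E2: (nth _ exceptions k') => [n' E'] /and4P[ltk' /eqP n'n pus /allP EE'].
apply: (exceptional_relabel pvs); exists k', us; rewrite E2; split=> // i j ltin ltjn ij.
have szus : size us = n by rewrite (perm_size pus) size_iota.
have us_lt a : (a < n)%N -> (nth 0%N us a < n)%N.
  move=> ltan; have : nth 0%N us a \in us by rewrite mem_nth ?szus.
  by rewrite (perm_mem pus) mem_iota.
have := EE' (i, j); rewrite mem_index_pairs ltin ltjn => /(_ isT) /=; rewrite ij => /eqP->.
rewrite -eE ?us_lt ?negbK// nth_uniq ?szus//.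
by rewrite (perm_uniq pus) iota_uniq.
Qed.

Lemma nordhaus_gaddum_compl n (e : rel nat) :
  nordhaus_gaddum n (fun i j => ~~ e i j) -> nordhaus_gaddum n e.
Proof.
case=> [/exceptional_compl|[c [c' [b b' cc']]]]; first by left.
right; exists c', c; split; rewrite 1?addnC//.
by apply: spectral_bound_ext b' => i j _; rewrite negbK.
Qed.

Lemma nordhaus_gaddum_relabel n (e : rel nat) us : perm_eq us (iota 0 n) ->
  nordhaus_gaddum n (relabel e us) -> nordhaus_gaddum n e.
Proof.
move=> pus [/(exceptional_relabel pus)|[c [c' [b b' cc']]]]; first by left.
right; exists c, c'; split=> //; first exact: spectral_bound_relabel b.
exact: (@spectral_bound_relabel R n (fun i j => ~~ e i j) us c' pus b').
Qed.

(** Relabelling and complementation turn a proof for one partial graph into a proof for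
    another one, because the claim is invariant under both. *)
Lemma checkP n known st t (e : rel nat) :
  (forall st', st' \in known -> forall e', symmetric e' -> realizes e' st' -> nordhaus_gaddum n e') ->
  check n known st t -> symmetric e -> realizes e st -> nordhaus_gaddum n e.
Proof.
move=> knownP; elim: t st e => [g h|k u h|k u|ij t1 IH1 t0 IH0|k u|t IH] st e /=.
- case/and3P=> gin hin le_n es [e1 e0]; right.
  exists (packing_cost n (packing g)), (packing_cost n (packing h)); split=> //.
    by apply: spectral_bound_packing => //; exact: packing_in_sub gin.
  apply: (@spectral_bound_packing R n (fun i j => ~~ e i j)) => [i j|]; first by rewrite es.
  exact: packing_in_sub hin.
- case E: (nth _ _ _) => [[m E'] c] /andP[ltk /and5P[/eqP mn pus ref hin le_n]] es est.
  have := realizes_refines est ref es; move: E.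
  set T := nth (Model 0 [::] [::]) rigid_models k.
  rewrite (nth_map (Model 0 [::] [::]))// -/T => -[mE <- cE]; rewrite -mE in mn.
  have Tspec : spectral_model T := all_nthP _ rigid_models_spectral _ ltk.
  move=> eE; right; exists c, (packing_cost n (packing h)); split=> //.
    apply: (spectral_bound_relabel pus); rewrite -cE.
    move: eE; rewrite -mn => eE; apply: spectral_bound_ext (spectral_model_bound R Tspec).
    by move=> i j ij; rewrite (realizes_partial_of eE).
  apply: (@spectral_bound_packing R n (fun i j => ~~ e i j)) => [i j|]; first by rewrite es.
  by apply: packing_in_sub hin; case: est.
- case E: (nth _ _ _) => [m E'] /and4P[ltk /eqP mn pus ref] es est.
  have eE := realizes_refines est ref es.
  left; exists k, (digits u); rewrite E; split=> // i j ltin ltjn ij.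
  exact: realizes_partial_of eE _ _ _.
- case: (digits ij) => [//|i [//|j [|//]]] /andP[ok1 ok0] es est.
  have [eij|eij] := boolP (e i j).
    apply: (IH1 _ _ ok1 es); case: est => e1 e0; split=> // a b; rewrite edge_cons.
    by case/or3P=> [/andP[/eqP-> /eqP->]//|/andP[/eqP-> /eqP->]|/e1//]; rewrite es.
  apply: (IH0 _ _ ok0 es); case: est => e1 e0; split=> // a b; rewrite edge_cons.
  by case/or3P=> [/andP[/eqP-> /eqP->]//|/andP[/eqP-> /eqP->]|/e0//]; rewrite es.
- case/and3P=> ltk pus ref es est; apply: (nordhaus_gaddum_relabel pus).
  apply: (knownP _ (mem_nth ([::], [::]) ltk)).
    by move=> i j; exact: es.
  exact: realizes_refines est ref es.
- move=> ok es [e1 e0]; apply: nordhaus_gaddum_compl.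
  apply: (IH _ _ ok) => [i j|]; first by rewrite es.
  by split=> // i j ij; rewrite negbK; exact: e1.
Qed.

Lemma check_casesP n known cases (e : rel nat) :
  (forall st', st' \in known -> forall e', symmetric e' -> realizes e' st' -> nordhaus_gaddum n e') ->
  check_cases n known cases -> symmetric e -> nordhaus_gaddum n e.
Proof.
move=> + + es; elim: cases known => [|[[l u] t] cases IH] known knownP /= ok.
  by apply: (knownP _ ok e es); split=> i j; rewrite /edge !in_nil.
case/andP: ok => ok okr; apply: IH okr => st'; rewrite mem_rcons inE => /orP[/eqP->|].
  by move=> e' es'; exact: checkP ok es'.
exact: knownP.
Qed.
End Soundness.

(** * The branching tables and the theorem *)

(** In each table the auxiliary cases are ordered by decreasing number of vertices, and a
    case refers to larger ones. *)

Open Scope dec_uint_scope.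

Definition cases_3 : seq (nat * Number.uint * proof_tree) := [::
  (0%N, 0, Split 01 (Split 02 (Split 12 (Pack 0012 80) (Dual (Rigid 0 120 80))) (Split 12 (Dual
  (Rigid 0 021 80)) (Rigid 0 012 80))) (Split 02 (Split 12 (Dual (Rigid 0 012 80)) (Rigid 0 021
  80)) (Split 12 (Rigid 0 120 80) (Pack 80 0012))))].

Definition cases_4 : seq (nat * Number.uint * proof_tree) := [::
  (3%N, 12, Split 13 (Split 03 (Split 23 (Dual (Rigid 1 1023 0123)) (Excl 0 0312)) (Split 23 (Pack
  0123 20123) (Rigid 1 2130 0023))) (Split 23 (Split 03 (Excl 0 0321) (Rigid 1 1230 0013)) (Pack
  80 10132)));
  (3%N, 0, Split 03 (Split 13 (Split 23 (Pack 23012 0012) (Rigid 1 0312 0012)) (Split 23 (Rigid 1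
  0321 0012) (Pack 80 10132))) (Split 13 (Split 23 (Rigid 1 1320 0012) (Pack 80 10123)) (Pack 80
  10213)));
  (0%N, 0, Split 01 (Split 02 (Split 12 (Dual (Case 1 0123)) (Dual (Case 0 0123))) (Split 12 (Dual
  (Case 0 1023)) (Case 0 2013))) (Split 02 (Split 12 (Dual (Case 0 2013)) (Case 0 1023)) (Split 12
  (Case 0 0123) (Case 1 0123))))].

Definition cases_5 : seq (nat * Number.uint * proof_tree) := [::
  (4%N, 121323, Split 14 (Split 24 (Pack 11324 20123) (Split 34 (Pack 11234 20123) (Pack 0123
  10243))) (Split 24 (Split 34 (Pack 11243 20123) (Pack 0123 10143)) (Pack 0123 10142)));
  (4%N, 1323, Split 14 (Split 24 (Pack 11324 0012) (Split 34 (Split 04 (Excl 3 04132) (Pack 0134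
  10124)) (Split 04 (Excl 1 04132) (Rigid 2 23140 10124)))) (Split 34 (Split 04 (Split 24 (Excl 3
  04231) (Pack 23124 10142)) (Pack 23124 10214)) (Split 24 (Split 04 (Excl 1 04231) (Rigid 2 13240
  10143)) (Pack 80 530412))));
  (4%N, 120323, Split 04 (Split 14 (Split 24 (Split 34 (Dual (Rigid 2 20134 10324)) (Excl 2
  20134)) (Split 34 (Excl 2 31024) (Pack 303214 301342))) (Split 24 (Pack 10324 21034) (Split 34
  (Pack 0034 10142) (Excl 1 12304)))) (Split 34 (Split 14 (Pack 11234 20124) (Split 24 (Excl 3
  03421) (Pack 23024 10142))) (Split 24 (Pack 22134 10134) (Split 14 (Excl 1 03214) (Rigid 2 03214
  10134)))));
  (4%N, 23, Split 24 (Split 34 (Pack 0234 10213) (Split 04 (Split 14 (Pack 24012 10213) (Rigid 2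
  04231 10143)) (Split 14 (Rigid 2 14230 10134) (Pack 80 520134)))) (Split 34 (Split 04 (Split 14
  (Pack 24013 10213) (Rigid 2 04321 10142)) (Split 14 (Rigid 2 14320 10124) (Pack 80 530124)))
  (Pack 80 542301)));
  (4%N, 1203, Split 04 (Split 34 (Pack 0034 10132) (Split 14 (Split 24 (Pack 0124 10132) (Excl 1
  21403)) (Split 24 (Excl 1 12403) (Pack 80 501234)))) (Split 14 (Split 24 (Pack 0124 10132)
  (Split 34 (Excl 1 03412) (Pack 80 510324))) (Split 24 (Split 34 (Excl 1 03421) (Pack 80 520314))
  (Pack 80 531204))));
  (4%N, 0, Split 04 (Split 14 (Split 24 (Pack 24012 10123) (Split 34 (Pack 24013 10123) (Pack 80
  542301))) (Split 24 (Split 34 (Pack 24023 10123) (Pack 80 541302)) (Pack 80 541203))) (Split 14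
  (Split 24 (Split 34 (Pack 24123 10123) (Pack 80 540312)) (Pack 80 540213)) (Pack 80 540123)));
  (3%N, 12, Split 13 (Split 23 (Split 03 (Dual (Case 1 31204)) (Case 0 01234)) (Split 03 (Case 2
  02134) (Case 1 02314))) (Split 23 (Split 03 (Case 2 01234) (Case 1 01324)) (Split 03 (Case 4
  01234) (Case 3 03124))));
  (3%N, 0, Split 03 (Split 13 (Split 23 (Dual (Case 0 30124)) (Case 1 20134)) (Split 23 (Case 1
  10234) (Case 3 12034))) (Split 13 (Split 23 (Case 1 01234) (Case 3 02134)) (Split 23 (Case 3
  01234) (Case 5 01234))));
  (0%N, 0, Split 01 (Split 02 (Split 12 (Dual (Case 7 01234)) (Dual (Case 6 01234))) (Split 12
  (Dual (Case 6 10234)) (Case 6 20134))) (Split 02 (Split 12 (Dual (Case 6 20134)) (Case 6 10234))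
  (Split 12 (Case 6 01234) (Case 7 01234))))].

Definition cases_6 : seq (nat * Number.uint * proof_tree) := [::
  (5%N, 121323142434, Split 15 (Split 25 (Pack 551234 20123) (Split 35 (Pack 551324 20123) (Pack
  11234 10253))) (Split 25 (Split 35 (Pack 552314 20123) (Pack 11234 10153)) (Pack 11234 10152)));
  (5%N, 1323142434, Split 15 (Split 25 (Pack 551234 0012) (Split 35 (Split 45 (Pack 523415 0012)
  (Pack 11324 10254)) (Pack 11324 10253))) (Split 25 (Split 35 (Split 45 (Pack 513425 0012) (Pack
  11324 10154)) (Pack 11324 10153)) (Pack 11324 10152)));
  (5%N, 23142434, Split 25 (Split 35 (Pack 12435 10213) (Split 15 (Pack 11425 10213) (Split 45
  (Pack 12345 10213) (Pack 0234 4021354)))) (Split 35 (Split 15 (Pack 11435 10213) (Split 45 (Pack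
  12354 10213) (Pack 0234 4031254))) (Pack 0234 552301)));
  (5%N, 03142434, Split 35 (Split 15 (Pack 11435 10132) (Split 25 (Pack 12435 10132) (Split 45
  (Split 05 (Pack 10345 10132) (Pack 24123 531205)) (Pack 24123 4013254)))) (Split 05 (Split 45
  (Pack 10345 10132) (Pack 24123 4012354)) (Pack 24123 550312)));
  (5%N, 142434, Split 15 (Split 25 (Pack 11425 10123) (Split 35 (Pack 11435 10123) (Pack 24123
  552301))) (Split 25 (Split 35 (Pack 12435 10123) (Pack 24123 551302)) (Pack 24123 551203)));
  (5%N, 1323042434, Split 25 (Split 45 (Split 15 (Pack 513524 0012) (Split 35 (Split 05 (Pack
  504523 0012) (Pack 12345 10215)) (Pack 12345 10153))) (Split 35 (Split 05 (Pack 504523 0012)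
  (Pack 12435 10145)) (Pack 0234 4021453))) (Split 05 (Split 15 (Pack 4042315 0012) (Split 35
  (Pack 10435 10152) (Pack 0234 530512))) (Split 45 (Split 15 (Pack 11345 10125) (Split 35 (Pack
  12354 10125) (Pack 0234 530512))) (Pack 0234 541502))));
  (5%N, 1213042434, Split 25 (Split 35 (Split 45 (Pack 512345 0023) (Split 05 (Pack 4042135 0023)
  (Pack 11243 10145))) (Split 05 (Pack 4043125 0023) (Pack 11243 10235))) (Split 35 (Split 05
  (Pack 4042135 0023) (Pack 11243 10325)) (Pack 11243 10253)));
  (5%N, 232434, Split 25 (Split 35 (Pack 12435 10213) (Split 45 (Pack 12345 10213) (Pack 0234
  4021354))) (Split 35 (Split 45 (Pack 12354 10213) (Pack 0234 4025413)) (Pack 0234 4025314)));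
  (5%N, 12032434, Split 45 (Split 05 (Pack 10345 10132) (Split 15 (Pack 11245 10132) (Split 25
  (Split 35 (Pack 12435 10132) (Pack 24235 4023514)) (Pack 24235 4041325)))) (Split 25 (Split 35
  (Pack 12435 10132) (Pack 22145 4014532)) (Split 35 (Pack 23045 4013254) (Pack 80 6014235))));
  (5%N, 012434, Split 45 (Pack 24235 540123) (Split 25 (Split 35 (Pack 12435 540123) (Split 05
  (Split 15 (Pack 0015 540123) (Pack 80 6023415)) (Pack 80 6045213))) (Split 05 (Split 15 (Pack
  0015 540123) (Pack 80 6023451)) (Pack 80 6045312))));
  (5%N, 2434, Split 45 (Pack 24235 540123) (Split 25 (Split 35 (Pack 12435 540123) (Split 05
  (Split 15 (Pack 25012 540123) (Pack 80 6023415)) (Pack 80 6045213))) (Split 35 (Split 05 (Split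
  15 (Pack 25013 540123) (Pack 80 6023451)) (Pack 80 6045312)) (Pack 80 6014235))));
  (5%N, 231434, Split 35 (Split 15 (Pack 11435 10124) (Split 45 (Split 25 (Pack 12345 10124) (Pack
  23245 4031524)) (Pack 23245 4024513))) (Split 45 (Split 25 (Pack 12345 10124) (Pack 24135
  4013524)) (Split 15 (Split 25 (Pack 314325 4012453) (Pack 80 6013425)) (Pack 80 6024315))));
  (5%N, 34, Split 35 (Split 45 (Pack 0345 503412) (Split 05 (Split 15 (Pack 25013 503412) (Split
  25 (Pack 25023 503412) (Pack 80 6013452))) (Split 15 (Split 25 (Pack 25123 503412) (Pack 80
  6013542)) (Pack 80 6023541)))) (Split 45 (Split 05 (Split 15 (Pack 25014 503412) (Split 25 (Pack
  25024 503412) (Pack 80 6014352))) (Split 15 (Split 25 (Pack 25124 503412) (Pack 80 6014532))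
  (Pack 80 6024531))) (Split 05 (Split 15 (Split 25 (Pack 25012 503412) (Pack 80 6013245)) (Pack
  80 6023145)) (Pack 80 6035124))));
  (5%N, 031323041424, Split 05 (Split 15 (Pack 4032415 0012) (Split 25 (Pack 4031425 0012) (Pack
  10314 10152))) (Split 15 (Split 25 (Pack 4031524 0012) (Pack 10314 10125)) (Pack 10314 10215)));
  (5%N, 13231424, Split 15 (Split 25 (Split 35 (Pack 541235 0012) (Split 45 (Pack 531245 0012)
  (Pack 11324 00120345))) (Split 35 (Split 45 (Pack 523415 0012) (Pack 11324 4012543)) (Pack 11324
  4012534))) (Split 35 (Split 45 (Split 25 (Pack 513425 0012) (Pack 11324 00340125)) (Pack 11324
  4021543)) (Pack 11324 4021534)));
  (5%N, 2314, Split 15 (Split 45 (Pack 0145 512304) (Split 25 (Split 35 (Pack 0235 512304) (Split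
  05 (Pack 25012 512304) (Pack 80 6012534))) (Split 35 (Split 05 (Pack 25013 512304) (Pack 80
  6013524)) (Pack 80 6012435)))) (Split 25 (Split 35 (Pack 0235 512304) (Split 45 (Split 05 (Pack
  25024 512304) (Pack 80 6024513)) (Pack 80 6012354))) (Split 35 (Split 45 (Split 05 (Pack 25034
  512304) (Pack 80 6034512)) (Pack 80 6013254)) (Pack 80 6024153))));
  (5%N, 0, Split 05 (Split 15 (Split 25 (Pack 25012 501234) (Split 35 (Pack 25013 501234) (Split
  45 (Pack 25014 501234) (Pack 80 6012345)))) (Split 25 (Split 35 (Pack 25023 501234) (Split 45
  (Pack 25024 501234) (Pack 80 6012354))) (Split 35 (Split 45 (Pack 25034 501234) (Pack 80
  6013254)) (Pack 80 6014253)))) (Split 15 (Split 25 (Split 35 (Pack 25123 501234) (Split 45 (Pack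
  25124 501234) (Pack 80 6012534))) (Split 35 (Split 45 (Pack 25134 501234) (Pack 80 6013524))
  (Pack 80 6014523))) (Split 25 (Split 35 (Split 45 (Pack 25234 501234) (Pack 80 6015234)) (Pack
  80 6015243)) (Pack 80 6015342))));
  (4%N, 121323, Split 14 (Split 24 (Split 34 (Split 04 (Dual (Case 4 412305)) (Case 0 012345))
  (Split 04 (Dual (Case 3 412305)) (Case 1 034125))) (Split 34 (Split 04 (Dual (Case 3 413205))
  (Case 1 024135)) (Split 04 (Dual (Case 6 142305)) (Case 2 042315)))) (Split 24 (Split 34 (Split
  04 (Dual (Case 3 423105)) (Case 1 014235)) (Split 04 (Dual (Case 6 241305)) (Case 2 041325)))
  (Split 34 (Split 04 (Dual (Case 6 341205)) (Case 2 041235)) (Split 04 (Dual (Case 13 123045))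
  (Case 7 041235)))));
  (4%N, 1323, Split 34 (Split 14 (Split 24 (Split 04 (Dual (Case 2 431205)) (Case 1 012345))
  (Split 04 (Case 5 021345) (Case 2 021435))) (Split 24 (Split 04 (Case 5 012345) (Case 2 012435))
  (Split 04 (Case 3 012435) (Case 4 012435)))) (Split 24 (Split 14 (Split 04 (Case 6 031245) (Case
  14 012345)) (Split 04 (Case 8 013425) (Case 11 014235))) (Split 14 (Split 04 (Case 8 023415)
  (Case 11 024135)) (Split 04 (Case 9 041235) (Case 10 041235)))));
  (4%N, 120323, Split 04 (Split 14 (Split 24 (Split 34 (Dual (Case 11 423105)) (Dual (Case 8
  243015))) (Split 34 (Dual (Case 8 342105)) (Pack 303214 301342))) (Split 24 (Split 34 (Dual
  (Case 3 234015)) (Case 6 103425)) (Split 34 (Dual (Case 6 320415)) (Case 8 140235)))) (Split 34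
  (Split 14 (Split 24 (Dual (Case 3 324105)) (Case 6 012435)) (Split 24 (Case 5 014235) (Case 3
  104235))) (Split 24 (Split 14 (Dual (Case 6 231405)) (Case 3 014325)) (Split 14 (Case 8 041325)
  (Case 11 401235)))));
  (4%N, 23, Split 24 (Split 34 (Split 04 (Split 14 (Dual (Case 1 423015)) (Case 2 102345)) (Split
  14 (Case 2 012345) (Case 7 012345))) (Split 04 (Split 14 (Case 3 301245) (Case 11 103245))
  (Split 14 (Case 11 013245) (Case 10 013425)))) (Split 34 (Split 04 (Split 14 (Case 3 201345)
  (Case 11 102345)) (Split 14 (Case 11 012345) (Case 10 012435))) (Split 04 (Split 14 (Case 9
  230145) (Case 15 102345)) (Split 14 (Case 15 012345) (Case 12 014235)))));
  (4%N, 1203, Split 04 (Split 14 (Split 24 (Split 34 (Dual (Case 14 403125)) (Dual (Case 6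
  401235))) (Split 34 (Dual (Case 6 410325)) (Case 8 230145))) (Split 24 (Split 34 (Dual (Case 6
  420315)) (Case 8 130245)) (Split 34 (Dual (Case 13 034125)) (Case 9 123405)))) (Split 34 (Split
  14 (Split 24 (Dual (Case 6 431205)) (Case 8 021345)) (Split 24 (Case 8 012345) (Case 9 120435)))
  (Split 14 (Split 24 (Dual (Case 13 124035)) (Case 9 032415)) (Split 24 (Case 9 031425) (Case 15
  401235)))));
  (4%N, 0, Split 04 (Split 14 (Split 24 (Split 34 (Dual (Case 0 401235)) (Case 4 301245)) (Split
  34 (Case 4 201345) (Case 10 230145))) (Split 24 (Split 34 (Case 4 102345) (Case 10 130245))
  (Split 34 (Case 10 120345) (Case 12 123045)))) (Split 24 (Split 14 (Split 34 (Case 4 012345)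
  (Case 10 031245)) (Split 34 (Case 10 012345) (Case 12 013245))) (Split 14 (Split 34 (Case 10
  021345) (Case 12 023145)) (Split 34 (Case 12 012345) (Case 16 012345)))));
  (3%N, 12, Split 13 (Split 23 (Split 03 (Dual (Case 18 312045)) (Case 17 012345)) (Split 03 (Case
  19 021345) (Case 18 023145))) (Split 23 (Split 03 (Case 19 012345) (Case 18 013245)) (Split 03
  (Case 21 012345) (Case 20 031245))));
  (3%N, 0, Split 13 (Split 23 (Split 03 (Dual (Case 17 301245)) (Case 18 012345)) (Split 03 (Case
  18 201345) (Case 20 021345))) (Split 23 (Split 03 (Case 18 102345) (Case 20 012345)) (Split 03
  (Case 20 120345) (Case 22 012345))));
  (0%N, 0, Split 01 (Split 02 (Split 12 (Dual (Case 24 012345)) (Dual (Case 23 012345))) (Split 12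
  (Dual (Case 23 102345)) (Case 23 201345))) (Split 02 (Split 12 (Dual (Case 23 201345)) (Case 23
  102345)) (Split 12 (Case 23 012345) (Case 24 012345))))].

Definition cases_7 : seq (nat * Number.uint * proof_tree) := [::
  (6%N, 12132314243415253545, Split 16 (Split 26 (Split 36 (Pack 6126453 20123) (Split 46 (Pack
  6126354 20123) (Pack 512345 10364))) (Split 36 (Split 46 (Pack 6125634 20123) (Pack 512345
  10264)) (Pack 512345 10263))) (Split 26 (Split 36 (Split 46 (Pack 6125364 20123) (Pack 512345
  10164)) (Pack 512345 10163)) (Pack 512345 10162)));
  (6%N, 132314243415253545, Split 16 (Split 26 (Split 46 (Pack 6135624 0012) (Split 36 (Pack
  6136452 0012) (Pack 513425 10364))) (Split 36 (Split 46 (Pack 6136524 0012) (Pack 513425 10264))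
  (Pack 513425 10263))) (Split 26 (Split 36 (Split 46 (Pack 6135462 0012) (Pack 513425 10164))
  (Pack 513425 10163)) (Pack 513425 012620345)));
  (6%N, 14243415253545, Split 16 (Split 26 (Pack 4143526 10123) (Split 36 (Pack 4142536 10123)
  (Pack 11425 562301))) (Split 26 (Split 36 (Pack 4142635 10123) (Pack 11425 561302)) (Pack 11425
  561203)));
  (6%N, 23243415253545, Split 26 (Split 36 (Pack 562345 10213) (Split 46 (Pack 562435 10213) (Pack
  12345 4021364))) (Split 36 (Split 46 (Pack 563425 10213) (Pack 12345 4026413)) (Pack 12345
  4026314)));
  (6%N, 03243415253545, Split 26 (Split 36 (Pack 562345 10132) (Split 06 (Pack 4034526 10132)
  (Pack 12435 4041236))) (Split 06 (Split 46 (Pack 4035246 10132) (Pack 12435 4013264)) (Pack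
  12435 4041326)));
  (6%N, 23143415253545, Split 16 (Split 36 (Pack 4145236 10124) (Split 26 (Pack 4143526 10124)
  (Pack 11435 4013624))) (Split 46 (Split 26 (Pack 4146235 10124) (Pack 11435 4031624)) (Pack
  11435 4024613)));
  (6%N, 043415253545, Split 46 (Split 36 (Pack 13546 541203) (Split 06 (Pack 004625123 541203)
  (Split 16 (Pack 11546 541203) (Split 26 (Pack 12546 541203) (Split 56 (Pack 13465 541203) (Rigid
  3 0612354 005611324)))))) (Split 06 (Split 36 (Pack 10436 541203) (Split 16 (Pack 4043516
  541203) (Pack 0345 6023146))) (Split 36 (Split 16 (Pack 11536 541203) (Pack 0345 6023641)) (Pack
  0345 6036124))));
  (6%N, 023415253545, Split 36 (Split 46 (Pack 13546 503412) (Split 06 (Pack 4025436 503412)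
  (Split 26 (Pack 12536 503412) (Pack 0345 6013642)))) (Split 06 (Split 26 (Pack 00260345 503412)
  (Split 46 (Pack 4025346 503412) (Pack 0345 6013426))) (Split 46 (Split 26 (Pack 12546 503412)
  (Pack 0345 6014632)) (Pack 0345 6036124))));
  (6%N, 3415253545, Split 36 (Split 46 (Pack 13546 503412) (Split 16 (Pack 11536 503412) (Split 26
  (Pack 12536 503412) (Pack 0345 6013462)))) (Split 46 (Split 16 (Pack 11546 503412) (Split 26
  (Pack 12546 503412) (Pack 0345 6014362))) (Split 16 (Split 26 (Pack 11526 503412) (Pack 0345
  6013246)) (Pack 0345 6023146))));
  (6%N, 1323142415253545, Split 16 (Split 36 (Split 26 (Pack 6136452 0012) (Split 46 (Pack 6136524
  0012) (Pack 513425 4012643))) (Split 46 (Split 26 (Pack 6135624 0012) (Pack 513425 4012634))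
  (Pack 513425 00120346))) (Split 26 (Split 36 (Split 46 (Pack 6135462 0012) (Pack 513425
  4021643)) (Pack 513425 4021634)) (Pack 513425 00340126)));
  (6%N, 231415253545, Split 16 (Split 46 (Pack 01460235 512304) (Split 26 (Pack 4145326 512304)
  (Split 36 (Pack 4145236 512304) (Pack 0145 6012436)))) (Split 46 (Split 26 (Pack 4146235 512304)
  (Split 36 (Pack 4146325 512304) (Pack 0145 6024163))) (Split 26 (Split 36 (Pack 01450236 512304)
  (Pack 0145 6012364)) (Pack 0145 6013264))));
  (6%N, 0415253545, Split 06 (Split 46 (Pack 004625123 501234) (Split 16 (Pack 304516 501234)
  (Split 26 (Pack 304526 501234) (Pack 25123 6013264)))) (Split 46 (Split 16 (Pack 11546 501234)
  (Split 26 (Pack 12546 501234) (Pack 25123 6016342))) (Split 16 (Split 26 (Pack 11526 501234)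
  (Pack 25123 6013624)) (Pack 25123 6016234))));
  (6%N, 15253545, Split 16 (Split 26 (Pack 11526 501234) (Split 36 (Pack 11536 501234) (Split 46
  (Pack 11546 501234) (Pack 25123 6012346)))) (Split 36 (Split 26 (Pack 12536 501234) (Split 46
  (Pack 13546 501234) (Pack 25123 6013264))) (Split 26 (Split 46 (Pack 12546 501234) (Pack 25123
  6012364)) (Pack 25123 6014263))));
  (6%N, 14243405253545, Split 26 (Split 36 (Pack 562345 10123) (Split 06 (Pack 4053426 10123)
  (Pack 12435 560312))) (Split 36 (Split 06 (Pack 4052436 10123) (Pack 12435 560213)) (Pack 12435
  562301)));
  (6%N, 1213243405253545, Split 16 (Split 46 (Split 26 (Pack 6126354 0014) (Split 36 (Pack 6136254
  0014) (Pack 512345 00140236))) (Split 56 (Split 26 (Pack 6126345 0014) (Pack 512345 4014623))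
  (Pack 512345 002311465))) (Pack 512345 002321456));
  (6%N, 12143405253545, Split 26 (Split 46 (Split 36 (Pack 4125364 10132) (Split 16 (Pack 4125346
  10132) (Pack 11254 4016324))) (Split 16 (Pack 4143526 10132) (Pack 11254 4016423))) (Split 16
  (Split 46 (Pack 4125346 10132) (Pack 11254 4013264)) (Pack 11254 4031624)));
  (6%N, 232434253545, Split 26 (Split 36 (Pack 562345 10213) (Split 46 (Pack 562435 10213) (Pack
  12345 4021364))) (Split 36 (Split 46 (Pack 563425 10213) (Pack 12345 4026413)) (Pack 12345
  4026314)));
  (6%N, 132434253545, Split 26 (Split 36 (Pack 562345 10123) (Split 16 (Pack 4134526 10123) (Pack
  12435 4023614))) (Split 16 (Split 46 (Pack 4135246 10123) (Pack 12435 4014623)) (Pack 12435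
  4032614)));
  (6%N, 12032434253545, Split 26 (Split 36 (Pack 562345 10132) (Split 06 (Pack 4034526 10132)
  (Split 46 (Split 56 (Pack 534526 10132) (Pack 12435 4015632)) (Pack 12435 4014632)))) (Split 16
  (Split 36 (Pack 4124536 10132) (Pack 12435 023610415)) (Split 46 (Split 06 (Pack 4035246 10132)
  (Pack 12435 4041326)) (Pack 12435 4013264))));
  (6%N, 021434253545, Split 26 (Split 06 (Pack 00260345 4042315) (Split 46 (Pack 12546 4042315)
  (Split 16 (Pack 4143526 4042315) (Pack 0345 6046321)))) (Split 56 (Split 46 (Pack 13465 4042315)
  (Split 16 (Pack 11456 4042315) (Pack 0345 6013462))) (Split 36 (Split 06 (Pack 4025436 4042315)
  (Pack 0345 6056312)) (Pack 0345 6015326))));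
  (6%N, 011234253545, Split 16 (Pack 034521026 4032415) (Split 26 (Split 06 (Pack 034510126
  4032415) (Split 36 (Pack 12536 4032415) (Pack 0345 6024631))) (Split 56 (Split 36 (Pack 13456
  4032415) (Pack 0345 6024361)) (Pack 0345 6023561))));
  (6%N, 1234253545, Split 26 (Split 16 (Pack 01260345 4032415) (Split 36 (Pack 12536 4032415)
  (Split 46 (Pack 12546 4032415) (Pack 0345 6023146)))) (Split 16 (Split 36 (Pack 4125436 4032415)
  (Split 46 (Pack 4125346 4032415) (Pack 0345 6013246))) (Split 36 (Split 46 (Pack 13546 4032415)
  (Pack 0345 6013462)) (Pack 0345 6014362))));
  (6%N, 0134253545, Split 36 (Split 26 (Pack 12536 4032415) (Split 56 (Pack 13456 4032415) (Split
  06 (Split 16 (Pack 00160345 4032415) (Pack 0345 6023561)) (Pack 0345 6056312)))) (Split 46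
  (Split 26 (Pack 12546 4032415) (Split 56 (Pack 13465 4032415) (Split 16 (Split 06 (Pack 00160345
  4032415) (Pack 0345 74352016)) (Pack 0345 74352106)))) (Split 16 (Split 06 (Pack 00160345
  4032415) (Pack 0345 6036214)) (Pack 0345 6023416))));
  (6%N, 34253545, Split 36 (Split 26 (Pack 12536 4032415) (Split 46 (Pack 13546 4032415) (Split 56
  (Pack 13456 4032415) (Pack 0345 6015246)))) (Split 46 (Split 26 (Pack 12546 4032415) (Split 56
  (Pack 13465 4032415) (Pack 0345 6015236))) (Split 26 (Split 06 (Split 16 (Pack 034526012
  4032415) (Pack 0345 6023146)) (Pack 0345 6036124)) (Pack 0345 6013246))));
  (6%N, 230414253545, Split 46 (Pack 023524016 4024315) (Split 06 (Split 16 (Pack 023510416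
  4024315) (Split 26 (Pack 4045326 4024315) (Pack 0235 6013264))) (Split 26 (Split 36 (Pack
  023624015 4024315) (Pack 0235 6012634)) (Pack 0235 6013624))));
  (6%N, 14253545, Split 16 (Split 26 (Pack 314526 4024315) (Split 36 (Pack 314536 4024315) (Split
  56 (Pack 11456 4024315) (Pack 25234 6015236)))) (Split 46 (Split 26 (Pack 12546 4024315) (Split
  36 (Pack 13546 4024315) (Pack 25234 6024163))) (Split 26 (Split 36 (Pack 12536 4024315) (Pack
  25234 6012364)) (Pack 25234 6013264))));
  (6%N, 1304253545, Split 06 (Split 36 (Pack 304536 4023415) (Split 16 (Pack 4045316 4023415)
  (Split 26 (Pack 304526 4023415) (Split 56 (Pack 10456 4023415) (Pack 25234 6015326))))) (Split
  46 (Split 16 (Pack 313546 4023415) (Split 36 (Pack 13546 4023415) (Pack 25234 6016243))) (Split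
  16 (Split 26 (Pack 313526 4023415) (Split 56 (Pack 11356 4023415) (Pack 25234 6015246))) (Pack
  25234 6016324))));
  (6%N, 01253545, Split 26 (Split 36 (Pack 12536 4023415) (Split 46 (Pack 12546 4023415) (Split 16
  (Split 06 (Pack 001625234 4023415) (Pack 25234 6036214)) (Pack 25234 6023416)))) (Split 06
  (Split 16 (Pack 001625234 4023415) (Split 36 (Split 46 (Pack 13546 4023415) (Pack 25234
  6023461)) (Pack 25234 6024361))) (Split 36 (Split 46 (Pack 13546 4023415) (Pack 25234 6026314))
  (Pack 25234 6026413))));
  (6%N, 253545, Split 26 (Split 36 (Pack 12536 4023415) (Split 46 (Pack 12546 4023415) (Split 16
  (Split 06 (Split 56 (Rigid 3 0134256 001512364) (Pack 25234 6015346)) (Pack 25234 6012634))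
  (Pack 25234 6012364)))) (Split 36 (Split 46 (Pack 13546 4023415) (Split 16 (Split 06 (Split 56
  (Rigid 3 0124356 001512346) (Pack 25234 6015246)) (Pack 25234 6013624)) (Pack 25234 6013264)))
  (Split 46 (Split 06 (Split 16 (Split 56 (Rigid 3 0123456 001512436) (Pack 25234 6015236)) (Pack
  25234 6014263)) (Pack 25234 6014623)) (Pack 25234 6012346))));
  (6%N, 23243405153545, Split 26 (Split 56 (Pack 562534 10213) (Split 06 (Pack 4053426 10213)
  (Pack 12354 4031256))) (Split 36 (Split 46 (Split 06 (Pack 4053246 10213) (Split 16 (Pack
  4153246 10213) (Pack 12354 530126))) (Pack 12354 4026413)) (Pack 12354 4026314)));
  (6%N, 2434153545, Split 36 (Split 16 (Pack 11536 4041325) (Split 26 (Pack 12436 4041325) (Split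
  46 (Pack 13546 4041325) (Pack 0345 6023461)))) (Split 16 (Split 26 (Pack 4153426 4041325) (Split
  46 (Pack 11546 4041325) (Pack 0345 6014236))) (Split 56 (Split 46 (Pack 13465 4041325) (Pack
  0345 6023416)) (Pack 0345 6025136))));
  (6%N, 231434053545, Split 36 (Split 46 (Pack 13546 4031524) (Split 56 (Pack 13456 4031524)
  (Split 06 (Pack 10536 4031524) (Pack 0345 6046125)))) (Split 26 (Split 46 (Pack 12346 4031524)
  (Split 16 (Pack 4145326 4031524) (Pack 0345 6024316))) (Split 46 (Split 56 (Pack 13465 4031524)
  (Pack 0345 6013256)) (Pack 0345 6013426))));
  (6%N, 0212343545, Split 26 (Pack 034522016 4031425) (Split 06 (Split 16 (Pack 034510216 4031425)
  (Split 36 (Split 46 (Pack 13546 4031425) (Pack 0345 6013462)) (Pack 0345 6014362))) (Split 36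
  (Split 46 (Pack 13546 4031425) (Pack 0345 6013642)) (Pack 0345 6014632))));
  (6%N, 12343545, Split 36 (Split 46 (Pack 13546 4031425) (Split 56 (Pack 13456 4031425) (Split 26
  (Split 16 (Pack 01260345 4031425) (Pack 0345 6024156)) (Pack 0345 6014256)))) (Split 16 (Split
  26 (Pack 01260345 4031425) (Split 46 (Split 56 (Pack 13465 4031425) (Pack 0345 6013256)) (Pack
  0345 6013246))) (Split 46 (Split 56 (Pack 13465 4031425) (Pack 0345 6023156)) (Pack 0345
  6023146))));
  (6%N, 343545, Split 36 (Split 46 (Pack 13546 4031425) (Split 56 (Pack 13456 4031425) (Split 26
  (Split 06 (Split 16 (Pack 034526012 4031425) (Pack 0345 6024156)) (Pack 0345 6046125)) (Pack
  0345 6014256)))) (Split 46 (Split 56 (Pack 13465 4031425) (Split 16 (Split 26 (Split 06 (Pack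
  034526012 4031425) (Pack 0345 6036125)) (Pack 0345 6013256)) (Pack 0345 6023156))) (Split 06
  (Split 16 (Split 26 (Pack 034526012 4031425) (Pack 0345 6013246)) (Pack 0345 6023146)) (Pack
  0345 6036124))));
  (6%N, 23143545, Split 56 (Pack 25346 6034512) (Split 36 (Pack 23256 6034512) (Split 46 (Pack
  24156 6034512) (Pack 80 71062354))));
  (6%N, 123545, Split 56 (Pack 25346 6015342) (Split 46 (Split 36 (Pack 13546 6015342) (Split 26
  (Split 16 (Pack 0126 6015342) (Pack 80 72064531)) (Pack 80 71064532))) (Split 26 (Split 16 (Pack
  0126 6015342) (Pack 80 72063541)) (Pack 80 71063542))));
  (6%N, 3545, Split 56 (Pack 25346 6015342) (Split 46 (Split 36 (Pack 13546 6015342) (Split 06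
  (Split 16 (Pack 26014 6015342) (Pack 80 70264531)) (Pack 80 71264530))) (Split 36 (Split 06
  (Split 26 (Pack 26023 6015342) (Pack 80 70163542)) (Pack 80 71263540)) (Pack 80 70162354))));
  (6%N, 0313243405152545, Split 46 (Split 36 (Pack 4036425 10214) (Split 16 (Pack 4031645 10214)
  (Pack 10315 4023614))) (Split 26 (Split 36 (Pack 4036245 10214) (Pack 10315 4012364)) (Pack
  10315 562401)));
  (6%N, 0334152545, Split 36 (Split 06 (Pack 003625124 4014235) (Split 56 (Pack 13456 4014235)
  (Split 16 (Pack 315436 4014235) (Pack 25124 6056231)))) (Split 46 (Split 06 (Pack 10346 4014235)
  (Split 16 (Pack 11546 4014235) (Pack 25124 6024631))) (Split 06 (Split 56 (Pack 303456 4014235)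
  (Pack 25124 6014536)) (Pack 25124 6046123))));
  (6%N, 1203342545, Split 46 (Pack 24356 6024531) (Split 56 (Pack 25246 6024531) (Split 36 (Pack
  23046 6024531) (Pack 80 72160345))));
  (6%N, 01342545, Split 46 (Pack 24356 6024531) (Split 56 (Pack 25246 6024531) (Split 26 (Split 36
  (Pack 325436 6024531) (Pack 80 70162543)) (Pack 80 70163452))));
  (6%N, 342545, Split 46 (Pack 24356 6024531) (Split 56 (Pack 25246 6024531) (Split 26 (Split 36
  (Pack 325436 6024531) (Pack 80 70162543)) (Pack 80 70163452))));
  (6%N, 2434051545, Split 06 (Split 16 (Pack 10516 4025314) (Split 26 (Pack 305426 4025314) (Split
  36 (Pack 305436 4025314) (Split 46 (Pack 10546 4025314) (Pack 24235 6014236))))) (Split 16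
  (Split 26 (Pack 315426 4025314) (Split 36 (Pack 315436 4025314) (Split 46 (Pack 11546 4025314)
  (Pack 24235 6014236)))) (Split 56 (Split 26 (Pack 12456 4025314) (Split 36 (Pack 13456 4025314)
  (Split 46 (Rigid 3 0123645 001412536) (Pack 24235 6014236)))) (Pack 24235 6016235))));
  (6%N, 45, Split 56 (Split 46 (Pack 0456 6014253) (Split 06 (Split 16 (Pack 26015 6014253) (Split
  36 (Pack 26035 6014253) (Pack 80 70265413))) (Split 16 (Split 26 (Pack 26125 6014253) (Pack 80
  71365402)) (Pack 80 72365401)))) (Split 46 (Split 06 (Split 16 (Pack 26014 6014253) (Split 26
  (Pack 26024 6014253) (Pack 80 70364512))) (Split 16 (Split 26 (Pack 26124 6014253) (Pack 80
  71364502)) (Pack 80 72364501))) (Split 06 (Split 26 (Split 16 (Pack 26012 6014253) (Pack 80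
  70263145)) (Pack 80 70163245)) (Pack 80 71263045))));
  (6%N, 0414243405152535, Split 06 (Split 16 (Pack 4042516 10123) (Split 26 (Pack 4041526 10123)
  (Pack 10415 561203))) (Split 16 (Split 26 (Pack 4041625 10123) (Pack 10415 560213)) (Pack 10415
  560123)));
  (6%N, 14243405152535, Split 16 (Split 26 (Pack 4143526 10123) (Split 36 (Pack 4142536 10123)
  (Pack 11425 562301))) (Split 26 (Split 36 (Pack 4142635 10123) (Pack 11425 561302)) (Pack 11425
  561203)));
  (6%N, 03142434152535, Split 36 (Split 16 (Pack 4142536 00450123) (Split 26 (Pack 4142635
  00450123) (Pack 11425 004511326))) (Split 46 (Split 56 (Split 06 (Pack 4034156 00450123) (Pack
  11425 560312)) (Pack 11425 4012365)) (Pack 11425 4012364)));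
  (6%N, 142434152535, Split 16 (Split 26 (Pack 4143526 00450123) (Split 36 (Pack 4142536 00450123)
  (Pack 11425 004511263))) (Split 26 (Split 36 (Pack 4142635 00450123) (Pack 11425 004511236))
  (Pack 11425 004511326)));
  (6%N, 3425, Split 26 (Split 36 (Split 46 (Pack 0346 6023145) (Split 56 (Pack 0256 6023145)
  (Split 06 (Pack 26023 6023145) (Pack 80 72163405)))) (Split 56 (Pack 0256 6023145) (Split 46
  (Split 06 (Pack 26024 6023145) (Pack 80 72164305)) (Pack 80 70162534)))) (Split 36 (Split 46
  (Pack 0346 6023145) (Split 56 (Split 06 (Pack 26035 6023145) (Pack 80 73165204)) (Pack 80
  70163425))) (Split 56 (Split 46 (Split 06 (Pack 26045 6023145) (Pack 80 74165203)) (Pack 80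
  70165234)) (Pack 80 70164325))));
  (6%N, 24340515, Split 46 (Pack 24236 6014235) (Split 56 (Pack 25016 6014235) (Split 06 (Split 16
  (Pack 10516 6014235) (Split 26 (Split 36 (Pack 12436 6014235) (Pack 80 70153426)) (Pack 80
  70152436))) (Split 26 (Split 36 (Pack 12436 6014235) (Pack 80 70342615)) (Pack 80 70243615)))));
  (6%N, 231405, Split 06 (Split 16 (Split 26 (Pack 26012 6012354) (Split 36 (Pack 26013 6012354)
  (Split 46 (Pack 0146 6012354) (Pack 80 70561423)))) (Split 56 (Pack 0056 6012354) (Split 26
  (Split 46 (Pack 26024 6012354) (Pack 80 72360514)) (Split 36 (Split 46 (Pack 26034 6012354)
  (Pack 80 70514236)) (Pack 80 70523146))))) (Split 16 (Split 46 (Pack 0146 6012354) (Split 26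
  (Split 56 (Pack 26125 6012354) (Pack 80 72361405)) (Split 36 (Split 56 (Pack 26135 6012354)
  (Pack 80 70236145)) (Pack 80 70234165)))) (Split 26 (Split 36 (Pack 0236 6012354) (Split 46
  (Split 56 (Pack 26245 6012354) (Pack 80 70146235)) (Pack 80 70143265))) (Split 46 (Split 36
  (Split 56 (Pack 26345 6012354) (Pack 80 70146325)) (Pack 80 70231465)) (Pack 80 70142365)))));
  (6%N, 0, Split 36 (Split 56 (Split 16 (Pack 26135 6012345) (Split 46 (Pack 26345 6012345) (Split
  06 (Pack 26035 6012345) (Pack 80 72365014)))) (Split 16 (Split 26 (Pack 26123 6012345) (Split 46
  (Pack 26134 6012345) (Pack 80 70163245))) (Split 26 (Split 06 (Pack 26023 6012345) (Pack 80
  72364015)) (Pack 80 70364125)))) (Split 56 (Split 06 (Split 16 (Pack 26015 6012345) (Split 26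
  (Pack 26025 6012345) (Pack 80 70465123))) (Split 46 (Split 16 (Pack 26145 6012345) (Pack 80
  72465013)) (Pack 80 71265034))) (Split 16 (Split 26 (Split 46 (Pack 26124 6012345) (Pack 80
  70162345)) (Pack 80 70164235)) (Pack 80 70264135))));
  (5%N, 121323142434, Split 15 (Split 25 (Split 35 (Split 45 (Split 05 (Dual (Case 12 5123406))
  (Case 0 0123456)) (Split 05 (Dual (Case 11 5123406)) (Case 1 0451236))) (Split 45 (Split 05
  (Dual (Case 11 5124306)) (Case 1 0351246)) (Pack 551234 10354))) (Split 45 (Split 35 (Split 05
  (Dual (Case 11 5134206)) (Case 1 0251346)) (Pack 551423 10253)) (Split 35 (Pack 551324 10254)
  (Split 05 (Dual (Case 46 1234506)) (Case 3 0523416))))) (Split 25 (Split 35 (Split 45 (Split 05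
  (Dual (Case 11 5234106)) (Case 1 0152346)) (Pack 552314 10154)) (Split 45 (Pack 552413 10153)
  (Split 05 (Dual (Case 46 2134506)) (Case 3 0513426)))) (Split 45 (Split 35 (Pack 553412 10152)
  (Split 05 (Dual (Case 46 4123506)) (Case 3 0512346))) (Split 35 (Split 05 (Dual (Case 46
  3124506)) (Case 3 0512436)) (Split 05 (Dual (Case 45 1234056)) (Case 16 0512346))))));
  (5%N, 1323142434, Split 15 (Split 25 (Split 35 (Split 45 (Split 05 (Dual (Case 8 5341206)) (Case
  1 0123456)) (Split 05 (Dual (Case 7 5341206)) (Case 9 0124536))) (Split 45 (Split 05 (Dual (Case
  7 5431206)) (Case 9 0123546)) (Pack 551234 10354))) (Split 35 (Split 45 (Split 05 (Dual (Case 6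
  5341206)) (Pack 523415 10125)) (Split 05 (Dual (Case 15 3541206)) (Case 5 0251436))) (Split 45
  (Split 05 (Dual (Case 15 4531206)) (Case 5 0251346)) (Split 05 (Dual (Case 38 3415206)) (Case 17
  0521346))))) (Split 25 (Split 35 (Split 45 (Split 05 (Dual (Case 6 5342106)) (Pack 513425
  10215)) (Split 05 (Dual (Case 15 3542106)) (Case 5 0152436))) (Split 45 (Split 05 (Dual (Case 15
  4532106)) (Case 5 0152346)) (Split 05 (Dual (Case 38 3425106)) (Case 17 0512346)))) (Split 45
  (Split 35 (Split 05 (Dual (Case 29 3451206)) (Case 2 0125346)) (Pack 11324 530512)) (Pack 11324
  540512))));
  (5%N, 23142434, Split 25 (Split 35 (Split 15 (Pack 514523 10213) (Split 45 (Split 05 (Dual (Case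
  13 4523106)) (Case 3 0123546)) (Split 05 (Case 18 0145236) (Case 17 0154236)))) (Split 15 (Split
  45 (Split 05 (Dual (Case 4 5423106)) (Case 5 0132546)) (Pack 11425 4021354)) (Split 45 (Split 05
  (Case 4 0135246) (Pack 12345 520135)) (Split 05 (Case 19 0153426) (Case 30 0153246))))) (Split
  35 (Split 15 (Split 45 (Split 05 (Dual (Case 4 5432106)) (Case 5 0123546)) (Pack 11435 4031254))
  (Split 45 (Split 05 (Case 4 0125346) (Pack 12354 530125)) (Split 05 (Case 19 0152436) (Case 30
  0152346)))) (Split 15 (Split 05 (Split 45 (Dual (Case 14 4523106)) (Case 20 0512346)) (Split 45
  (Case 10 0123546) (Case 21 0512346))) (Split 45 (Split 05 (Case 7 0152346) (Case 8 0152346))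
  (Split 05 (Case 22 0512346) (Case 23 0512346))))));
  (5%N, 03142434, Split 35 (Split 15 (Split 25 (Split 05 (Split 45 (Dual (Case 17 5430126)) (Case
  38 1204356)) (Split 45 (Dual (Case 29 4531206)) (Case 47 0123456))) (Split 05 (Split 45 (Dual
  (Case 4 4530126)) (Pack 11435 4013254)) (Split 45 (Case 4 0213546) (Pack 11435 4013254))))
  (Split 25 (Split 05 (Split 45 (Dual (Case 4 4530216)) (Pack 12435 4023154)) (Split 45 (Case 4
  0123546) (Pack 12435 4023154))) (Split 05 (Split 45 (Case 29 1203546) (Case 24 1205436)) (Split
  45 (Case 6 0125346) (Case 43 0512436))))) (Split 05 (Split 45 (Split 15 (Split 25 (Dual (Case 18
  4530126)) (Case 15 2031546)) (Split 25 (Case 15 1032546) (Pack 10345 501235))) (Split 25 (Pack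
  303425 4012354) (Split 15 (Pack 303415 4012354) (Case 39 5120346)))) (Split 15 (Split 25 (Pack
  11425 550312) (Split 45 (Case 7 0231546) (Case 26 0521346))) (Split 25 (Split 45 (Case 7
  0132546) (Case 26 0512346)) (Split 45 (Case 11 0125346) (Case 25 5012346))))));
  (5%N, 142434, Split 35 (Split 15 (Split 25 (Split 45 (Split 05 (Dual (Case 3 5412306)) (Case 2
  0123456)) (Split 05 (Case 46 0123456) (Case 48 0123456))) (Split 05 (Split 45 (Case 13 0213456)
  (Pack 11435 4013254)) (Pack 11435 550213))) (Split 25 (Split 05 (Split 45 (Case 13 0123456)
  (Pack 12435 4023154)) (Pack 12435 550123)) (Split 05 (Split 45 (Case 6 0123546) (Case 39
  0125346)) (Split 45 (Case 8 0123546) (Case 25 0512346))))) (Split 25 (Split 15 (Split 05 (Split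
  45 (Case 13 0312456) (Pack 11425 4012354)) (Pack 11425 550312)) (Split 05 (Split 45 (Case 6
  0132546) (Case 39 0135246)) (Split 45 (Case 8 0132546) (Case 25 0513246)))) (Split 15 (Split 05
  (Split 45 (Case 6 0231546) (Case 39 0235146)) (Split 45 (Case 8 0231546) (Case 25 0523146)))
  (Split 45 (Split 05 (Case 11 0123546) (Case 12 0123546)) (Split 05 (Case 27 0512346) (Case 28
  0512346))))));
  (5%N, 1323042434, Split 25 (Split 05 (Split 35 (Split 15 (Split 45 (Dual (Case 30 5342106))
  (Dual (Case 19 5342016))) (Split 45 (Dual (Case 6 3452016)) (Case 14 1045236))) (Split 15 (Split
  45 (Dual (Case 19 5432106)) (Pack 4042315 4021453)) (Split 45 (Dual (Case 15 4352016)) (Pack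
  10425 4021453)))) (Split 45 (Split 15 (Split 35 (Dual (Case 6 4352106)) (Case 14 0135246))
  (Split 35 (Dual (Case 13 3425106)) (Case 4 1053246))) (Split 35 (Split 15 (Dual (Case 15
  3452106)) (Case 4 0154236)) (Split 15 (Pack 11325 4021453) (Case 31 0152346))))) (Split 45
  (Split 15 (Split 05 (Split 35 (Dual (Case 31 3452106)) (Pack 4042315 10253)) (Split 35 (Dual
  (Case 4 4351206)) (Case 15 0152346))) (Split 35 (Split 05 (Dual (Case 4 3450216)) (Case 13
  0125346)) (Split 05 (Dual (Case 14 4305216)) (Case 6 1052346)))) (Split 05 (Split 35 (Split 15
  (Pack 4042315 11254) (Case 15 1052436)) (Split 15 (Pack 4042315 4021453) (Case 19 5102346)))
  (Split 35 (Split 15 (Dual (Case 14 3415206)) (Case 6 0152436)) (Split 15 (Case 19 5012436) (Case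
  30 5012346))))));
  (5%N, 1213042434, Split 35 (Split 25 (Split 15 (Split 45 (Split 05 (Dual (Case 21 5412306))
  (Dual (Case 7 4512306))) (Split 05 (Dual (Case 20 5412306)) (Pack 542315 10145))) (Split 45
  (Split 05 (Dual (Case 24 4523106)) (Case 14 0123546)) (Split 05 (Pack 4042135 00230145) (Case 47
  0154236)))) (Split 15 (Split 45 (Split 05 (Dual (Case 19 4513206)) (Pack 521435 10325)) (Pack
  11243 4014523)) (Split 05 (Pack 4042135 10152) (Split 45 (Case 15 0125346) (Pack 11243
  4014523))))) (Split 25 (Split 15 (Split 45 (Split 05 (Dual (Case 19 4512306)) (Pack 531425
  10235)) (Pack 11243 4014532)) (Split 05 (Pack 4043125 10153) (Split 45 (Case 15 0135246) (Pack
  11243 4014532)))) (Split 15 (Split 45 (Split 05 (Case 38 2301546) (Case 46 0235146)) (Pack 11243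
  4014523)) (Pack 11243 510523))));
  (5%N, 232434, Split 25 (Split 35 (Split 45 (Split 05 (Split 15 (Dual (Case 2 5234016)) (Case 3
  1023456)) (Split 15 (Case 3 0123456) (Case 16 0123456))) (Split 05 (Split 15 (Case 29 0142356)
  (Case 17 1045236)) (Split 15 (Case 17 0145236) (Pack 12435 520145)))) (Split 45 (Split 15 (Split
  05 (Case 29 0132456) (Case 17 0135246)) (Split 05 (Case 17 1035246) (Pack 12345 520135))) (Split
  05 (Split 15 (Case 24 0134526) (Case 21 1053426)) (Split 15 (Case 21 0153426) (Case 23
  0153426))))) (Split 45 (Split 35 (Split 15 (Split 05 (Case 29 0123456) (Case 17 0125346)) (Split
  05 (Case 17 1025346) (Pack 12354 530125))) (Split 05 (Split 15 (Case 24 0123546) (Case 21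
  1052346)) (Split 15 (Case 21 0152346) (Case 23 0152346)))) (Split 35 (Split 05 (Split 15 (Case
  24 0124536) (Case 21 1052436)) (Split 15 (Case 21 0152436) (Case 23 0152436))) (Split 05 (Split
  15 (Case 32 0152346) (Case 33 1052346)) (Split 15 (Case 33 0152346) (Case 34 0152346))))));
  (5%N, 12032434, Split 35 (Split 25 (Split 45 (Split 05 (Split 15 (Pack 4034215 10132) (Dual
  (Case 15 5234016))) (Split 15 (Dual (Case 15 5324106)) (Case 18 0123456))) (Split 05 (Split 15
  (Pack 4034215 10132) (Pack 12435 4023154)) (Pack 12435 4023145))) (Split 15 (Split 05 (Pack
  4034215 10132) (Pack 312435 4041325)) (Split 45 (Split 05 (Dual (Case 38 3542016)) (Case 19
  1025346)) (Split 05 (Case 20 1240536) (Case 39 1052436))))) (Split 25 (Split 05 (Split 15 (Pack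
  4034215 10132) (Pack 303425 4023514)) (Split 45 (Split 15 (Dual (Case 38 2543106)) (Case 19
  0135246)) (Split 15 (Case 20 0341526) (Case 39 0153426)))) (Split 45 (Split 05 (Pack 10345
  4025314) (Split 15 (Pack 11245 4025314) (Case 26 0152346))) (Split 05 (Split 15 (Pack 4034215
  6014235) (Case 40 1502436)) (Split 15 (Case 40 0513426) (Case 35 5012346))))));
  (5%N, 012434, Split 45 (Split 05 (Split 15 (Split 25 (Split 35 (Pack 12435 540123) (Dual (Case
  14 5401236))) (Split 35 (Dual (Case 14 5401326)) (Case 24 2301456))) (Split 35 (Split 25 (Pack
  12435 540123) (Case 19 1203456)) (Split 25 (Case 19 1302456) (Case 39 1230546)))) (Split 15
  (Split 35 (Split 25 (Pack 12435 540123) (Case 19 0213456)) (Split 25 (Case 19 0312456) (Case 39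
  0231546))) (Split 35 (Split 25 (Pack 12435 540123) (Case 22 0123546)) (Split 25 (Case 22
  0132546) (Case 27 0123546))))) (Split 25 (Split 35 (Pack 12435 540123) (Split 15 (Split 05 (Case
  20 3420156) (Case 40 0341526)) (Split 05 (Case 40 1340526) (Case 41 0135246)))) (Split 05 (Split
  15 (Split 35 (Case 20 2430156) (Case 32 2340156)) (Split 35 (Case 40 1240536) (Case 50
  1523406))) (Split 35 (Split 15 (Case 40 0241536) (Case 41 0125346)) (Split 15 (Case 50 0523416)
  (Case 36 5012346))))));
  (5%N, 2434, Split 45 (Split 25 (Split 35 (Pack 12435 540123) (Split 15 (Split 05 (Case 6
  3012456) (Case 30 0132456)) (Split 05 (Case 30 1032456) (Case 23 0132546)))) (Split 35 (Split 15
  (Split 05 (Case 6 2013456) (Case 30 0123456)) (Split 05 (Case 30 1023456) (Case 23 0123546)))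
  (Split 05 (Split 15 (Case 43 0123456) (Case 25 1023546)) (Split 15 (Case 25 0123546) (Case 28
  0123546))))) (Split 25 (Split 35 (Pack 12435 540123) (Split 05 (Split 15 (Case 39 3014256) (Case
  35 1034526)) (Split 15 (Case 35 0134526) (Case 42 0135246)))) (Split 35 (Split 05 (Split 15
  (Case 39 2014356) (Case 35 1024536)) (Split 15 (Case 35 0124536) (Case 42 0125346))) (Split 15
  (Split 05 (Case 50 0123456) (Case 36 0152346)) (Split 05 (Case 36 1052346) (Case 37
  0152346))))));
  (5%N, 231434, Split 35 (Split 15 (Split 25 (Split 45 (Split 05 (Dual (Case 5 5342106)) (Case 5
  0123456)) (Split 05 (Case 15 0412356) (Pack 11435 4031245))) (Split 45 (Split 05 (Case 4
  2013456) (Case 17 0213456)) (Pack 11435 4031254))) (Split 45 (Split 25 (Split 05 (Case 4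
  1024356) (Case 17 0124356)) (Split 05 (Case 31 0123456) (Case 30 0125346))) (Split 25 (Split 05
  (Case 19 1042536) (Case 21 0142536)) (Split 05 (Case 26 0124536) (Case 25 0125436))))) (Split 45
  (Split 25 (Split 15 (Split 05 (Case 15 0321456) (Pack 12345 4042135)) (Pack 12345 4035124))
  (Split 15 (Split 05 (Case 19 2031546) (Case 21 0231546)) (Split 05 (Case 26 0213546) (Case 25
  0215346)))) (Split 15 (Split 25 (Pack 314325 4012453) (Split 05 (Case 40 0235146) (Case 35
  0251346))) (Split 25 (Split 05 (Case 40 0145236) (Case 35 0152436)) (Split 05 (Case 41 0512346)
  (Case 42 0512346))))));
  (5%N, 34, Split 35 (Split 45 (Split 05 (Split 15 (Split 25 (Dual (Case 1 5340126)) (Case 8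
  2013456)) (Split 25 (Case 8 1023456) (Case 23 1203456))) (Split 15 (Split 25 (Case 8 0123456)
  (Case 23 0213456)) (Split 25 (Case 23 0123456) (Case 34 0123456)))) (Split 15 (Split 05 (Split
  25 (Case 11 4012356) (Case 25 2401356)) (Split 25 (Case 25 0412356) (Case 42 0214356))) (Split
  05 (Split 25 (Case 25 1402356) (Case 42 1204356)) (Split 25 (Case 42 0124356) (Case 37
  0124536))))) (Split 45 (Split 15 (Split 05 (Split 25 (Case 11 3012456) (Case 25 2301456)) (Split
  25 (Case 25 0312456) (Case 42 0213456))) (Split 05 (Split 25 (Case 25 1302456) (Case 42
  1203456)) (Split 25 (Case 42 0123456) (Case 37 0123546)))) (Split 05 (Split 25 (Split 15 (Case
  27 3401256) (Case 36 1340256)) (Split 15 (Case 36 2340156) (Case 49 1203456))) (Split 25 (Split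
  15 (Case 36 0341256) (Case 49 0123456)) (Split 15 (Case 49 0213456) (Case 44 0125346))))));
  (5%N, 031323041424, Split 05 (Split 35 (Split 25 (Split 45 (Split 15 (Dual (Case 33 5340126))
  (Dual (Case 22 3450216))) (Split 15 (Dual (Case 32 3540126)) (Dual (Case 20 3450216)))) (Split
  15 (Split 45 (Dual (Case 22 3450126)) (Dual (Case 20 3450126))) (Split 45 (Pack 513405 10152)
  (Case 38 1254036)))) (Split 45 (Split 15 (Split 25 (Dual (Case 32 4530126)) (Dual (Case 20
  4350126))) (Split 25 (Dual (Case 20 4350216)) (Case 38 1253046))) (Split 15 (Pack 4032415
  00120345) (Split 25 (Pack 4031425 00120345) (Case 47 5120346))))) (Split 25 (Split 15 (Split 45
  (Split 35 (Dual (Case 22 3451206)) (Dual (Case 20 4351206))) (Split 35 (Dual (Case 20 3451206))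
  (Pack 4031524 00120345))) (Split 35 (Split 45 (Pack 503425 10215) (Case 38 0154236)) (Split 45
  (Case 38 0153246) (Case 47 5012346)))) (Split 15 (Split 35 (Split 45 (Pack 503415 10125) (Case
  38 0254136)) (Split 45 (Case 38 0253146) (Case 47 5021346))) (Split 35 (Split 45 (Case 45
  0125346) (Case 46 5012436)) (Split 45 (Case 46 5012346) (Case 48 5012346))))));
  (5%N, 13231424, Split 15 (Split 25 (Split 45 (Split 35 (Split 05 (Dual (Case 10 5134206)) (Case
  9 0123456)) (Split 05 (Case 14 0312456) (Pack 531245 10435))) (Split 35 (Split 05 (Case 14
  0412356) (Pack 541235 10345)) (Split 05 (Case 47 0345126) (Case 48 0345126)))) (Split 35 (Split
  45 (Split 05 (Case 14 0234156) (Pack 523415 10125)) (Pack 11324 4012543)) (Pack 11324 4012534)))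
  (Split 35 (Split 45 (Split 25 (Split 05 (Case 14 0134256) (Pack 513425 10215)) (Split 05 (Case
  47 0125346) (Case 48 0125346))) (Pack 11324 4021543)) (Pack 11324 4021534)));
  (5%N, 1203230414, Split 05 (Split 45 (Pack 4032145 301342) (Split 35 (Pack 4041235 301342) (Pack
  303214 4013542))) (Split 15 (Split 25 (Pack 4032514 301342) (Pack 303214 4013425)) (Pack 303214
  4024315)));
  (5%N, 2314, Split 25 (Split 15 (Split 35 (Split 45 (Split 05 (Dual (Case 9 5142306)) (Case 10
  0123456)) (Split 05 (Case 7 4012356) (Case 21 0412356))) (Split 45 (Split 05 (Case 7 3021456)
  (Case 21 0321456)) (Split 05 (Case 26 3401256) (Case 35 0341256)))) (Split 45 (Split 35 (Split
  05 (Case 7 1042356) (Case 21 0142356)) (Split 05 (Case 26 1302456) (Case 35 0132456))) (Split 35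
  (Split 05 (Case 22 1402356) (Case 33 0142356)) (Split 05 (Case 41 1403256) (Case 36 0143526)))))
  (Split 45 (Split 35 (Split 15 (Split 05 (Case 7 2031456) (Case 21 0231456)) (Split 05 (Case 26
  1203456) (Case 35 0123456))) (Split 15 (Split 05 (Case 22 2301456) (Case 33 0231456)) (Split 05
  (Case 41 2301456) (Case 36 0231546)))) (Split 15 (Split 35 (Split 05 (Case 26 2401356) (Case 35
  0241356)) (Split 05 (Case 41 2304156) (Case 36 0234516))) (Split 35 (Split 05 (Case 41 1402356)
  (Case 36 0142536)) (Split 05 (Case 51 0123456) (Case 49 0512346))))));
  (5%N, 0, Split 15 (Split 25 (Split 05 (Split 35 (Split 45 (Dual (Case 0 5012346)) (Case 12
  4012356)) (Split 45 (Case 12 3012456) (Case 28 3401256))) (Split 35 (Split 45 (Case 12 0123456)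
  (Case 28 0412356)) (Split 45 (Case 28 0312456) (Case 37 0341256)))) (Split 35 (Split 05 (Split
  45 (Case 12 2013456) (Case 28 2401356)) (Split 45 (Case 28 0213456) (Case 37 0241356))) (Split
  45 (Split 05 (Case 28 2301456) (Case 37 0231456)) (Split 05 (Case 37 2340156) (Case 44
  0234156))))) (Split 05 (Split 25 (Split 35 (Split 45 (Case 12 1023456) (Case 28 1402356)) (Split
  45 (Case 28 1302456) (Case 37 1340256))) (Split 35 (Split 45 (Case 28 1203456) (Case 37
  1240356)) (Split 45 (Case 37 1230456) (Case 44 1234056)))) (Split 25 (Split 35 (Split 45 (Case
  28 0123456) (Case 37 0142356)) (Split 45 (Case 37 0132456) (Case 44 0134256))) (Split 35 (Split
  45 (Case 37 0123456) (Case 44 0124356)) (Split 45 (Case 44 0123456) (Case 52 0123456))))));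
  (4%N, 121323, Split 34 (Split 24 (Split 14 (Split 04 (Dual (Case 57 4123056)) (Case 53 0123456))
  (Split 04 (Dual (Case 56 4231056)) (Case 54 0142356))) (Split 14 (Split 04 (Dual (Case 56
  4132056)) (Case 54 0241356)) (Split 04 (Dual (Case 59 3412056)) (Case 55 0412356)))) (Split 14
  (Split 24 (Split 04 (Dual (Case 56 4123056)) (Case 54 0341256)) (Split 04 (Dual (Case 59
  1423056)) (Case 55 0423156))) (Split 24 (Split 04 (Dual (Case 59 2413056)) (Case 55 0413256))
  (Split 04 (Dual (Case 66 1230456)) (Case 60 0412356)))));
  (4%N, 1323, Split 34 (Split 14 (Split 24 (Split 04 (Dual (Case 55 4312056)) (Case 54 0123456))
  (Split 04 (Case 58 0213456) (Case 55 0214356))) (Split 24 (Split 04 (Case 58 0123456) (Case 55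
  0124356)) (Split 04 (Case 56 0124356) (Case 57 0124356)))) (Split 24 (Split 14 (Split 04 (Case
  59 0312456) (Case 67 0123456)) (Split 04 (Case 61 0134256) (Case 64 0142356))) (Split 14 (Split
  04 (Case 61 0234156) (Case 64 0241356)) (Split 04 (Case 62 0412356) (Case 63 0412356)))));
  (4%N, 120323, Split 14 (Split 04 (Split 24 (Split 34 (Dual (Case 64 4231056)) (Dual (Case 61
  2430156))) (Split 34 (Dual (Case 61 3421056)) (Case 68 0123456))) (Split 34 (Split 24 (Dual
  (Case 56 3241056)) (Case 59 0124356)) (Split 24 (Dual (Case 59 2314056)) (Case 61 0413256))))
  (Split 24 (Split 04 (Split 34 (Dual (Case 56 2340156)) (Case 59 1034256)) (Split 34 (Case 58
  0142356) (Case 56 0143256))) (Split 34 (Split 04 (Dual (Case 59 3204156)) (Case 56 1042356))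
  (Split 04 (Case 61 1402356) (Case 64 4012356)))));
  (4%N, 23, Split 34 (Split 24 (Split 04 (Split 14 (Dual (Case 54 4230156)) (Case 55 1023456))
  (Split 14 (Case 55 0123456) (Case 60 0123456))) (Split 14 (Split 04 (Case 56 2013456) (Case 64
  0123456)) (Split 04 (Case 64 1023456) (Case 63 0124356)))) (Split 24 (Split 14 (Split 04 (Case
  56 3012456) (Case 64 0132456)) (Split 04 (Case 64 1032456) (Case 63 0134256))) (Split 04 (Split
  14 (Case 62 2301456) (Case 69 1023456)) (Split 14 (Case 69 0123456) (Case 65 0142356)))));
  (4%N, 1203, Split 34 (Split 14 (Split 04 (Split 24 (Dual (Case 67 4031256)) (Dual (Case 59
  4103256))) (Split 24 (Dual (Case 59 4312056)) (Case 61 0213456))) (Split 24 (Split 04 (Dual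
  (Case 59 4203156)) (Case 61 0123456)) (Split 04 (Dual (Case 66 0341256)) (Case 62 1204356))))
  (Split 04 (Split 24 (Split 14 (Dual (Case 59 4012356)) (Case 61 1302456)) (Split 14 (Case 61
  2301456) (Case 62 1234056))) (Split 24 (Split 14 (Dual (Case 66 1240356)) (Case 62 0314256))
  (Split 14 (Case 62 0324156) (Case 69 4012356)))));
  (4%N, 0, Split 24 (Split 14 (Split 04 (Split 34 (Dual (Case 53 4012356)) (Case 57 3012456))
  (Split 34 (Case 57 0123456) (Case 63 0312456))) (Split 04 (Split 34 (Case 57 1023456) (Case 63
  1302456)) (Split 34 (Case 63 0123456) (Case 65 0132456)))) (Split 04 (Split 14 (Split 34 (Case
  57 2013456) (Case 63 2301456)) (Split 34 (Case 63 1203456) (Case 65 1230456))) (Split 14 (Split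
  34 (Case 63 0213456) (Case 65 0231456)) (Split 34 (Case 65 0123456) (Case 70 0123456)))));
  (3%N, 12, Split 13 (Split 23 (Split 03 (Dual (Case 72 3120456)) (Case 71 0123456)) (Split 03
  (Case 73 0213456) (Case 72 0231456))) (Split 23 (Split 03 (Case 73 0123456) (Case 72 0132456))
  (Split 03 (Case 75 0123456) (Case 74 0312456))));
  (3%N, 0, Split 23 (Split 03 (Split 13 (Dual (Case 71 3012456)) (Case 72 1023456)) (Split 13
  (Case 72 0123456) (Case 74 0123456))) (Split 13 (Split 03 (Case 72 2013456) (Case 74 0213456))
  (Split 03 (Case 74 1203456) (Case 76 0123456))));
  (0%N, 0, Split 01 (Split 02 (Split 12 (Dual (Case 78 0123456)) (Dual (Case 77 0123456))) (Split
  12 (Dual (Case 77 1023456)) (Case 77 2013456))) (Split 02 (Split 12 (Dual (Case 77 2013456))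
  (Case 77 1023456)) (Split 12 (Case 77 0123456) (Case 78 0123456))))].

Close Scope dec_uint_scope.

Lemma nordhaus_gaddum_le7 (R : realType) n (e : rel nat) : (n <= 7)%N -> symmetric e ->
  nordhaus_gaddum R n e.
Proof.
move=> n7 es; have [n2|n3] := leqP n 2.
  right; exists (packing_cost n [::]), (packing_cost n [::]); split.
  - exact: spectral_bound_packing.
  - by apply: (@spectral_bound_packing R n (fun i j => ~~ e i j)) => // i j; rewrite es.
  - by rewrite /packing_cost subn0 leq_add2l.
have cases_all c : check_cases n [::] c -> nordhaus_gaddum R n e by move=> ok; exact: check_casesP ok es.
case: n n7 n3 cases_all => [|[|[|[|[|[|[|[|//]]]]]]]] //= _ _ cases_all.
- by apply: (cases_all cases_3); vm_compute.
- by apply: (cases_all cases_4); vm_compute.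
- by apply: (cases_all cases_5); vm_compute.
- by apply: (cases_all cases_6); vm_compute.
- by apply: (cases_all cases_7); vm_compute.
Qed.

Section Adjacency.
Variables (n : nat) (G : sgraph n).

Definition nat_adj : rel nat := fun i j =>
  oapp (fun i' => oapp (G i') false (insub j)) false (insub i).

Lemma nat_adjE (i j : 'I_n) : nat_adj i j = G i j.
Proof. by rewrite /nat_adj !valK. Qed.

Lemma nat_adj_sym : symmetric nat_adj.
Proof.
move=> i j; rewrite /nat_adj; case: (insubP 'I_n i) => [i' _ _|_] /=.
  by case: (insubP 'I_n j) => [j' _ _|_] //=; exact: adj_sym.
by case: (insubP 'I_n j) => [j' _ _|_].
Qed.

Lemma iso_of_relabel m (H : sgraph m) E us : m = n -> perm_eq us (iota 0 n) ->
  (forall a b : 'I_m, a != b -> H a b = edge E a b) ->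
  (forall i j, (i < n)%N -> (j < n)%N -> i != j -> relabel nat_adj us i j = edge E i j) ->
  graph_iso G H.
Proof.
move=> mn; subst m => pus HE GE.
have szus : size us = n by rewrite (perm_size pus) size_iota.
have inus (i : 'I_n) : val i \in us by rewrite (perm_mem pus) mem_iota add0n ltn_ord.
have lt_index (i : 'I_n) : (index (val i) us < n)%N by have := inus i; rewrite -index_mem szus.
pose f i : 'I_n := Ordinal (lt_index i).
have f_inj : injective f.
  by move=> i j [/(congr1 (nth 0%N us))]; rewrite !nth_index ?inus// => /val_inj.
exists f; split=> [|i j]; first exact: injF_bij.
have [->|ij] := eqVneq i j; first by rewrite !adj_irr.
rewrite HE ?(inj_eq f_inj)// -GE//; last by rewrite (inj_eq val_inj) (inj_eq f_inj).
by rewrite /relabel !nth_index ?inus// nat_adjE.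
Qed.

End Adjacency.

Theorem theorem5p9 (R : realType) (n : nat) (G : sgraph n)
    (hn : (n <= 7)%N)
    (hP4 : ~ graph_iso G (path_graph 4))
    (hP5 : ~ graph_iso G (path_graph 5))
    (hP5c : ~ graph_iso G (compl (path_graph 5)))
    (hT22 : ~ graph_iso G T22) :
  (q R G + q R (compl G) <= n + 2)%N.
Proof.
case: (nordhaus_gaddum_le7 R hn (nat_adj_sym G)) => [[k [us [ltk]]]|[c [c' [b b' cc']]]].
  move: ltk; do 4?[case: k => [|k]] => // _ /= nE pus GE; exfalso.
  - apply: hP4; apply: (iso_of_relabel nE pus _ GE).
    by do 2![case=> [[|[|[|[|//]]]] ?]].
  - apply: hP5; apply: (iso_of_relabel nE pus _ GE).
    by do 2![case=> [[|[|[|[|[|//]]]]] ?]].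
  - apply: hP5c; apply: (iso_of_relabel nE pus _ GE).
    by do 2![case=> [[|[|[|[|[|//]]]]] ?]].
  - apply: hT22; apply: (iso_of_relabel nE pus _ GE).
    by do 2![case=> [[|[|[|[|[|//]]]]] ?]].
apply: leq_trans (leq_add _ _) cc'; apply: q_le.
  by apply: spectral_bound_ext b => i j _; rewrite nat_adjE.
by apply: spectral_bound_ext b' => i j ij; rewrite nat_adjE /= /compl_rel ij.
Qed.
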